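(* Let $a,b,c,d\in{\bf C}^*\setminus\{1\}$ with $abcd=1$, and let $C_1,C_2,C_3,C_4\subset GL(3,{\bf C})$ be the conjugacy classes of diagonalizable matrices with eigenvalues respectively $(a,1,1)$, $(b,1,1)$, $(c,1,1)$, $(d,1,1)$. Let ${\cal V}=\{(M_1,M_2,M_3,M_4)~|~M_j\in C_j,~M_1M_2M_3M_4=I\}$. Let ${\cal T}\subset{\cal V}$ be the set of quadruples with trivial centralizer and let ${\cal S}\subset{\cal V}$ be the set of quadruples defining direct sums of an irreducible representation of rank $2$ and a one-dimensional representation. Then ${\cal T}$ and ${\cal S}$ are both non-empty, $\dim{\cal T}=8$ (the expected dimension $\sum_{j=1}^4\dim C_j-3^2+1$ of ${\cal V}$) and $\dim{\cal S}=9$.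
   Context: The centralizer of a quadruple is the set of matrices commuting with all four matrices; it is trivial if it consists only of scalar matrices. A quadruple $(M_1,\ldots,M_4)$ with $M_1M_2M_3M_4=I$ is viewed as a representation on ${\bf C}^3$ (of the group generated by $\gamma_1,\ldots,\gamma_4$ with $\gamma_1\gamma_2\gamma_3\gamma_4=1$, $\gamma_j\mapsto M_j$). Dimensions are complex dimensions. *)

(* Defs.v *)
From mathcomp Require Import all_boot all_order all_algebra.
From mathcomp Require Import boolp classical_sets reals.
From mathcomp Require Import mpoly.

Set Implicit Arguments.
Unset Strict Implicit.
Unset Printing Implicit Defensive.

Import GRing.Theory VectorInternalTheory.
Local Open Scope classical_set_scope.
Local Open Scope ring_scope.

Section KrullDimension.
Variables (K : fieldType) (E : vectType K).
Implicit Types (X F G : set E).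

(* [v2r] gives linear coordinates on E; the closed sets do not depend on this
   choice. *)
Definition zariski_closed F : Prop :=
  exists P : set {mpoly K[dim E]},
    F = [set u | forall p, P p -> p.@[fun i => v2r u 0 i] = 0].

Definition zariski_closed_in X (Z : set E) : Prop :=
  exists2 F, zariski_closed F & Z = X `&` F.

Definition zariski_irreducible (Z : set E) : Prop :=
  Z !=set0 /\
  forall F G, zariski_closed F -> zariski_closed G ->
    Z `<=` F `|` G -> Z `<=` F \/ Z `<=` G.

Definition irreducible_chain X (n : nat) (Z : nat -> set E) : Prop :=
  (forall i, (i <= n)%N ->
     zariski_closed_in X (Z i) /\ zariski_irreducible (Z i)) /\
  (forall i, (i < n)%N -> Z i `<` Z i.+1).

(* Krull dimension of X with the topology induced by the Zariski topology of E.
   For constructible X it is the dimension of the Zariski closure of X, which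
   over the complex numbers is the usual complex dimension.  The empty set has
   no dimension. *)
Definition has_dim X (n : nat) : Prop :=
  (exists Z, irreducible_chain X n Z) /\
  (forall m Z, irreducible_chain X m Z -> (m <= n)%N).

End KrullDimension.

Section Quadruples.
Variable K : fieldType.

Definition quadruple (n : nat) := {ffun 'I_4 -> 'M[K]_n}.

Definition conj_class n (D : 'M[K]_n) : set 'M[K]_n :=
  [set M | exists2 P, P \in unitmx & M = P *m D *m invmx P].

(* The class of diagonalizable matrices with eigenvalues x, 1, 1. *)
Definition reflection_class (x : K) : set 'M[K]_3 :=
  conj_class (diag_mx (\row_(i < 3) if i == 0 then x else 1)).

(* The relation of the group generated by g_1, ..., g_4 with
   g_1 g_2 g_3 g_4 = 1; it makes all four matrices invertible. *)
Definition is_rep n (M : quadruple n) : Prop :=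
  M (inord 0) *m M (inord 1) *m M (inord 2) *m M (inord 3) = 1%:M.

Definition trivial_centralizer n (M : quadruple n) : Prop :=
  forall A : 'M[K]_n, (forall j, comm_mx A (M j)) -> is_scalar_mx A.

(* Matrices act on column vectors. *)
Definition invariant_subspace n (M : quadruple n) (U : {vspace 'cV[K]_n}) :=
  forall j v, v \in U -> M j *m v \in U.

Definition irreducible_rep n (M : quadruple n) : Prop :=
  [/\ is_rep M, (0 < n)%N &
    forall U, invariant_subspace M U -> U = 0%VS \/ U = fullv].

Definition direct_sum n1 n2 (A : quadruple n1) (B : quadruple n2) :
    quadruple (n1 + n2) :=
  [ffun j => block_mx (A j) 0 0 (B j)].

Definition equiv_rep n (M N : quadruple n) : Prop :=
  exists2 P : 'M[K]_n, P \in unitmx & forall j, M j = P *m N j *m invmx P.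

Definition variety_V (C : 'I_4 -> set 'M[K]_3) : set (quadruple 3) :=
  [set M : quadruple 3 | (forall j, C j (M j)) /\ is_rep M].

Definition subset_T (C : 'I_4 -> set 'M[K]_3) : set (quadruple 3) :=
  [set M : quadruple 3 | variety_V C M /\ trivial_centralizer M].

Definition subset_S (C : 'I_4 -> set 'M[K]_3) : set (quadruple 3) :=
  [set M : quadruple 3 | variety_V C M /\
    exists (A : quadruple 2) (B : quadruple 1),
      [/\ irreducible_rep A, is_rep B & equiv_rep M (direct_sum A B)]].

End Quadruples.

(* Main.v *)
(* Reflections M_j = 1 + u_j v_j with product 1 in dimension 3 satisfy
   rank (u_j) + rank (v_j) <= 4.  A quadruple with trivial centralizer cannot
   have both ranks <= 2, since a matrix w r with v_j w = 0 and r u_j = 0 would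
   commute with all the M_j; so, up to transposition, the v_j are parallel and
   the u_j span, which leaves 2 parameters for the direction of the v_j and 2
   for each of u_0, u_1, u_2.  In a direct sum with an irreducible summand of
   rank 2 the other summand is trivial, so M_j = 1 + P (A_j - 1) Q with
   Q P = 1: there are 4 parameters for (P, Q) and 6 for A_0, A_1, A_2, and one
   relation, on the trace of A_0 A_1 A_2, for A_3 to be a reflection.
   A chain of length m yields m functions that are algebraically independent
   on its last term, so the dimension is at most n on a set covered by the
   images of hypersurfaces of affine (n+1)-space.  Conversely, the closures of
   the images of a flag of coordinate flats under an n-parameter chart form a
   chain of length n, provided suitable functions separate consecutive ones. *)
From HB Require Import structures.
Require Import Defs.
From mathcomp Require Import all_boot all_order all_algebra.
From mathcomp Require Import boolp classical_sets reals.
From mathcomp Require Import complex mpoly.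
From mathcomp Require Import ring.

Set Implicit Arguments.
Unset Strict Implicit.
Unset Printing Implicit Defensive.

Import GRing.Theory Num.Theory VectorInternalTheory.
Local Open Scope classical_set_scope.
Local Open Scope ring_scope.

(** * Upper bounds on the Krull dimension *)

(** The two dimensions differ in how the last matrix is constrained. If all the [v_j] are parallel
    to one row v, then v is a common left eigenvector, the last matrix is 1 + w v, and v w is fixed
    by the product of the ratios: no equation is left. In rank 2 the product of the ratios only
    fixes the determinant of A_0 A_1 A_2, so the trace remains as an equation. That equation is why
    the upper bound uses hypersurfaces in one more variable: it then need not be solved. Where the
    parameters are free, a dummy last coordinate, required to vanish, plays the part of the
    equation. The upper bound is also local, because a chart only reaches the points where certain
    entries are nonzero; one point of the top term of a chain is enough, since that term is
    irreducible. For the lower bound a single chart suffices, so there the trace equation is solved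
    for one parameter. This introduces a denominator, and is the reason for working with functions
    regular off the zeros of a polynomial [q]. *)

Lemma widen_ord_lift n (i : 'I_n) : widen_ord (leqnSn n) i = lift ord_max i.
Proof. by apply: val_inj; rewrite /= /bump leqNgt ltn_ord. Qed.

Section MpolyLastVariable.
Variables (K : comNzRingType) (n : nat).

Definition meval_last (v : 'I_n -> K) (t : K) (Q : {poly {mpoly K[n]}}) : K :=
  (map_poly (meval v) Q).[t].

Lemma meval_muni (p : {mpoly K[n.+1]}) (v : 'I_n.+1 -> K) :
  p.@[v] = meval_last (fun i => v (widen_ord (leqnSn n) i)) (v ord_max) (muni p).
Proof.
rewrite /meval_last muniE mevalE rmorph_sum /= horner_sum.
apply: eq_bigr => m _; rewrite map_polyZ /= map_polyXn hornerZ hornerXn.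
rewrite mevalZ mevalX big_ord_recr /= mulrA; congr (_ * _ * _).
by apply: eq_bigr => i _; rewrite mnmE.
Qed.

Lemma muni_eq0 (p : {mpoly K[n.+1]}) : muni p = 0 -> p = 0.
Proof.
move=> p0; apply/mpolyP => m; rewrite mcoeff0.
have /(congr1 (fun q : {poly {mpoly K[n]}} => (q`_(m ord_max))@_
  [multinom [tuple m (widen_ord (leqnSn n) i) : nat | i < n]])) := p0.
rewrite muniE coef_sum coef0 mcoeff0 raddf_sum /= => {p0} p0.
rewrite -p0 {1}[p]mpolyE raddf_sum /=.
apply: eq_bigr => m' _; rewrite coefZ coefXn mcoeffZ mcoeffX.
case: (eqVneq m' m) => [->|neq]; first by rewrite eqxx !mulr1 mcoeffZ mcoeffX eqxx mulr1.
case: (eqVneq (m ord_max) (m' ord_max)) => [e|_]; last by rewrite !mulr0 mcoeff0.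
rewrite !mulr1 mcoeffZ mcoeffX; case: eqP => [e2|_]; last by rewrite mulr0.
case/eqP: neq; apply/mnmP => i; case: (unliftP ord_max i) => [j ->|-> //].
have {e2}/mnmP/(_ j) := e2; rewrite !mnmE.
by rewrite widen_ord_lift.
Qed.

End MpolyLastVariable.

(** Induction on the number of variables: at a point where the leading coefficient in the last
    variable is nonzero there remains a nonzero univariate polynomial, and it has too few roots to
    vanish at that many natural numbers, which are distinct in [K]. *)
Lemma mpoly_neq0_meval (K : numFieldType) n (p : {mpoly K[n]}) :
  p != 0 -> exists v, p.@[v] != 0.
Proof.
elim: n p => [|n IH] p p0.
  exists (fun=> 0); move: p0; rewrite (nvar0_mpolyC p).
  by rewrite mevalC mpolyC_eq0.
have q0 : muni p != 0 by apply: contra_neq p0 => /muni_eq0.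
have /IH[v vP] : lead_coef (muni p) != 0 by rewrite lead_coef_eq0.
pose Q := map_poly (meval v) (muni p).
have Q0 : Q != 0.
  by apply: contraNneq vP => Q0; rewrite -[_.@[v]]coef_map /= -/Q Q0 coef0.
have [t /negP tP] : exists t : K, ~ root Q t.
  apply/existsNP => H.
  have /= := @max_poly_roots _ Q [seq i%:R | i <- iota 0 (size Q)] Q0.
  rewrite size_map size_iota ltnn => contra; apply/notF/contra.
    by apply/allP => x /mapP[i _ ->]; apply: H.
  by rewrite map_inj_uniq ?iota_uniq// => i j /eqP; rewrite eqr_nat => /eqP.
exists (fun i => oapp v t (unlift ord_max i)).
rewrite meval_muni unlift_none /= /meval_last.
rewrite (_ : map_poly _ _ = Q)//.
apply: eq_map_poly => r; apply: meval_eq => i.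
by rewrite widen_ord_lift liftK.
Qed.

(** * Algebras of scalar functions, and matrices with entries in them *)

Section FunctionAlgebras.
Variables (K : comNzRingType) (T : Type).

(** Both the polynomial functions on a space and the regular functions on the source of a chart are
    instances, so the closure lemmas below serve on either side of a chart. *)
Definition fun_algebra (A : set (T -> K)) : Prop :=
  [/\ forall c, A (fun=> c),
      forall f g, A f -> A g -> A (fun x => f x + g x) &
      forall f g, A f -> A g -> A (fun x => f x * g x)].

Variables (A : set (T -> K)) (algA : fun_algebra A).

Lemma algebra_cst c : A (fun=> c). Proof. by case: algA. Qed.

Lemma algebraD f g : A f -> A g -> A (fun x => f x + g x).
Proof. by case: algA => _ + _; apply. Qed.

Lemma algebraM f g : A f -> A g -> A (fun x => f x * g x).
Proof. by case: algA => _ _; apply. Qed.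

Lemma algebraN f : A f -> A (fun x => - f x).
Proof.
move=> Af; rewrite (_ : (fun x => - f x) = (fun x => -1 * f x)).
  by apply: algebraM => //; apply: algebra_cst.
by apply/funext => x; rewrite mulN1r.
Qed.

Lemma algebraB f g : A f -> A g -> A (fun x => f x - g x).
Proof. by move=> Af Ag; apply: algebraD => //; apply: algebraN. Qed.

Lemma algebra_sum I (r : seq I) (P : pred I) (f : I -> T -> K) :
  (forall i, A (f i)) -> A (fun x => \sum_(i <- r | P i) f i x).
Proof.
move=> Af; elim: r => [|i r IH].
  by under eq_fun do rewrite big_nil; apply: algebra_cst.
by under eq_fun do rewrite big_cons; case: (P i) => //; apply: algebraD.
Qed.

Lemma algebra_prod I (r : seq I) (P : pred I) (f : I -> T -> K) :
  (forall i, A (f i)) -> A (fun x => \prod_(i <- r | P i) f i x).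
Proof.
move=> Af; elim: r => [|i r IH].
  by under eq_fun do rewrite big_nil; apply: algebra_cst.
by under eq_fun do rewrite big_cons; case: (P i) => //; apply: algebraM.
Qed.

Lemma algebraX n f : A f -> A (fun x => f x ^+ n).
Proof.
move=> Af; elim: n => [|n IH]; first exact: algebra_cst.
by under eq_fun do rewrite exprS; apply: algebraM.
Qed.

Lemma algebra_meval n (p : {mpoly K[n]}) (f : 'I_n -> T -> K) :
  (forall i, A (f i)) -> A (fun x => p.@[fun i => f i x]).
Proof.
move=> Af; under eq_fun do rewrite mevalE.
apply: algebra_sum => m; apply: algebraM; first exact: algebra_cst.
by apply: algebra_prod => i; apply: algebraX.
Qed.

Definition mx_algebra m n (F : T -> 'M[K]_(m, n)) : Prop :=
  forall i j, A (fun x => F x i j).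

Lemma mx_algebra_cst m n (M : 'M[K]_(m, n)) : mx_algebra (fun=> M).
Proof. by move=> i j; apply: algebra_cst. Qed.

Lemma mx_algebraD m n (F G : T -> 'M[K]_(m, n)) :
  mx_algebra F -> mx_algebra G -> mx_algebra (fun x => F x + G x).
Proof.
by move=> aF aG i j; under eq_fun do rewrite mxE; apply: algebraD.
Qed.

Lemma mx_algebraN m n (F : T -> 'M[K]_(m, n)) :
  mx_algebra F -> mx_algebra (fun x => - F x).
Proof.
by move=> aF i j; under eq_fun do rewrite mxE; apply: algebraN.
Qed.

Lemma mx_algebraB m n (F G : T -> 'M[K]_(m, n)) :
  mx_algebra F -> mx_algebra G -> mx_algebra (fun x => F x - G x).
Proof. by move=> aF aG; apply: mx_algebraD => //; apply: mx_algebraN. Qed.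

Lemma mx_algebraM m n p (F : T -> 'M[K]_(m, n)) (G : T -> 'M[K]_(n, p)) :
  mx_algebra F -> mx_algebra G -> mx_algebra (fun x => F x *m G x).
Proof.
move=> aF aG i j; under eq_fun do rewrite mxE.
by apply: algebra_sum => k; apply: algebraM.
Qed.

Lemma mx_algebraZ m n f (F : T -> 'M[K]_(m, n)) :
  A f -> mx_algebra F -> mx_algebra (fun x => f x *: F x).
Proof.
by move=> af aF i j; under eq_fun do rewrite mxE; apply: algebraM.
Qed.

Lemma algebra_det n (F : T -> 'M[K]_n) : mx_algebra F -> A (fun x => \det (F x)).
Proof.
move=> aF; apply: algebra_sum => s; apply: algebraM; first exact: algebra_cst.
by apply: algebra_prod => i; apply: aF.
Qed.

Lemma algebra_trace n (F : T -> 'M[K]_n) : mx_algebra F -> A (fun x => \tr (F x)).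
Proof. by move=> aF; apply: algebra_sum => i; apply: aF. Qed.

End FunctionAlgebras.

(** * Polynomial functions, and independent functions along a chain *)

Section PolynomialFunctions.
Variables (K : numFieldType) (E : vectType K).

Definition polyfun : set (E -> K) :=
  [set f | exists p : {mpoly K[dim E]}, forall u, f u = p.@[fun i => v2r u 0 i]].

(** On the locus where [q] is nonzero these are the elements of the localization at [q]; the values
    elsewhere are unconstrained. For [q := 1] they are the polynomial functions ([regular1P]). *)
Definition regular n (q : {mpoly K[n]}) : set (('I_n -> K) -> K) :=
  [set f | exists N (p : {mpoly K[n]}), forall x,
    q.@[x] != 0 -> f x * q.@[x] ^+ N = p.@[x]].

Definition regular_map n (q : {mpoly K[n]}) (phi : ('I_n -> K) -> E) : Prop :=
  forall f, polyfun f -> regular q (fun x => f (phi x)).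

Lemma polyfun_algebra : fun_algebra polyfun.
Proof.
split=> [c|f g [p pE] [q qE]|f g [p pE] [q qE]].
- by exists c%:MP => u; rewrite mevalC.
- by exists (p + q) => u; rewrite mevalD pE qE.
- by exists (p * q) => u; rewrite mevalM pE qE.
Qed.

Lemma regular_algebra n (q : {mpoly K[n]}) : fun_algebra (regular q).
Proof.
split=> [c|f g [N [p pE]] [N' [p' pE']]|f g [N [p pE]] [N' [p' pE']]].
- by exists 0%N, c%:MP => u; rewrite mevalC mulr1.
- exists (N + N')%N, (p * q ^+ N' + p' * q ^+ N) => u q0.
  rewrite mevalD !mevalM !rmorphXn /= -pE// -pE'// exprD; ring.
- exists (N + N')%N, (p * p') => u q0.
  rewrite mevalM -pE// -pE'// exprD; ring.
Qed.

Lemma regular_coord n (q : {mpoly K[n]}) i : regular q (fun x => x i).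
Proof. by exists 0%N, 'X_i => x _; rewrite mevalXU mulr1. Qed.

Lemma regularV n (q : {mpoly K[n]}) : regular q (fun x => (q.@[x])^-1).
Proof. by exists 1%N, 1 => x q0; rewrite expr1 mulVf// meval1. Qed.

Lemma regular1P n (f : ('I_n -> K) -> K) :
  regular 1 f -> exists p : {mpoly K[n]}, forall x, f x = p.@[x].
Proof.
move=> [N [p pE]]; exists p => x; rewrite -pE meval1 ?oner_neq0//.
by rewrite expr1n mulr1.
Qed.

Lemma polyfun_coord i : polyfun (fun u => v2r u 0 i).
Proof. by exists 'X_i => u; rewrite mevalXU. Qed.

Lemma polyfun_linear (f : {linear E -> K^o}) : polyfun f.
Proof.
rewrite (_ : (f : E -> K) =
  fun u => \sum_i v2r u 0 i * (f (r2v (delta_mx 0 i)) : K)).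
  apply: (algebra_sum polyfun_algebra) => i.
  apply: (algebraM polyfun_algebra); first exact: polyfun_coord.
  exact: (algebra_cst polyfun_algebra).
apply/funext => u; rewrite -{1}[u]v2rK [v2r u in LHS]row_sum_delta.
by rewrite !linear_sum; apply: eq_bigr => i _; rewrite !linearZ.
Qed.

Lemma regular_mapP n (q : {mpoly K[n]}) (phi : ('I_n -> K) -> E) :
  (forall i, regular q (fun x => v2r (phi x) 0 i)) -> regular_map q phi.
Proof.
move=> rphi f [p pE]; under eq_fun do rewrite pE.
exact: (algebra_meval (regular_algebra q)).
Qed.

Lemma zariski_closed_zeros (P : set (E -> K)) : P `<=` polyfun ->
  zariski_closed [set u | forall f, P f -> f u = 0].
Proof.
move=> Ppoly.
exists [set p | P (fun u => p.@[fun i => v2r u 0 i])].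
apply/seteqP; split=> [u uP p /uP//|u uP f Pf].
have [p pE] := Ppoly _ Pf; rewrite pE; apply: uP => /=.
by rewrite (_ : (fun _ => _) = f)//; apply/funext => v; rewrite pE.
Qed.

Lemma zariski_closed_zero f : polyfun f -> zariski_closed [set u | f u = 0].
Proof.
move=> pf; rewrite (_ : [set _ | _] = [set u | forall g, [set f] g -> g u = 0]).
  by apply: zariski_closed_zeros => _ ->.
by apply/seteqP; split=> [u fu g ->|u]//=; apply.
Qed.

Lemma irreducible_mul (Z : set E) f g : zariski_irreducible Z ->
  polyfun f -> polyfun g -> (forall z, Z z -> f z * g z = 0) ->
  (forall z, Z z -> f z = 0) \/ (forall z, Z z -> g z = 0).
Proof.
move=> [_ irrZ] pf pg fg0.
apply: irrZ (zariski_closed_zero pf) (zariski_closed_zero pg) _ => z Zz.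
by have /eqP := fg0 z Zz; rewrite mulf_eq0 => /orP[] /eqP; [left|right].
Qed.

Lemma closed_in_separate (X Z Z' : set E) :
  zariski_closed_in X Z -> Z' `<=` X -> Z `<` Z' ->
  exists f, [/\ polyfun f, forall z, Z z -> f z = 0 &
    exists2 z, Z' z & f z != 0].
Proof.
move=> [F [P ->] ->] Z'X [_ /existsNP[z /not_implyP[Z'z nz]]].
apply: contrapT => H; apply: nz; split; first exact: Z'X.
move=> p Pp; apply: contrapT => /eqP pz; apply: H.
exists (fun u => p.@[fun i => v2r u 0 i]); split; first by exists p.
  by move=> u [_ /(_ p Pp)].
by exists z.
Qed.

Definition alg_indep_on (Z : set E) m (f : 'I_m -> E -> K) : Prop :=
  forall P : {mpoly K[m]}, (forall z, Z z -> P.@[fun i => f i z] = 0) -> P = 0.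

(** Read a relation as a polynomial in [g]. Its constant coefficient vanishes on [Z], where [g]
    does, so it is zero by independence; what remains is [g] times a relation of lower degree, and
    irreducibility of [Z'] allows cancelling [g]. *)
Lemma alg_indep_extend (Z Z' : set E) m (f : 'I_m -> E -> K) g :
  zariski_irreducible Z' -> Z `<=` Z' ->
  (forall i, polyfun (f i)) -> polyfun g -> alg_indep_on Z f ->
  (forall z, Z z -> g z = 0) -> (exists2 z, Z' z & g z != 0) ->
  alg_indep_on Z' (fun i => oapp f g (unlift ord_max i)).
Proof.
move=> irrZ' ZZ' pf pg indf g0 [w Z'w gw] P P0; apply: muni_eq0.
have {}P0 z : Z' z -> meval_last (fun i => f i z) (g z) (muni P) = 0.
  move=> /P0; rewrite meval_muni unlift_none /= => <-.
  by congr meval_last; apply/funext => i; rewrite widen_ord_lift liftK.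
have mevalE Q c z : meval_last (fun i => f i z) (g z) (Q * 'X + c%:P) =
    meval_last (fun i => f i z) (g z) Q * g z + c.@[fun i => f i z].
  by rewrite /meval_last rmorphD rmorphM /= map_polyX map_polyC !hornerE.
have poly_meval Q : polyfun (fun z => meval_last (fun i => f i z) (g z) Q).
  elim/poly_ind: Q => [|Q c IH].
    under eq_fun do rewrite /meval_last rmorph0 horner0.
    exact: (algebra_cst polyfun_algebra).
  under eq_fun do rewrite mevalE.
  apply: (algebraD polyfun_algebra); first exact: (algebraM polyfun_algebra).
  exact: (algebra_meval polyfun_algebra).
elim/poly_ind: (muni P) P0 => // Q c IH Q0.
have c0 : c = 0.
  apply: indf => z Zz; have := Q0 z (ZZ' _ Zz).
  by rewrite mevalE g0// mulr0 add0r.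
rewrite c0 addr0 IH ?mul0r// => z Z'z.
have [//|H|/(_ w Z'w)/eqP] := irreducible_mul irrZ' (poly_meval Q) pg; last 2 first.
- exact: H.
- by rewrite (negPf gw).
by move=> u Z'u; have := Q0 u Z'u; rewrite mevalE c0 meval0 addr0.
Qed.

(* Successive differences of the chain: the i-th function vanishes on the i-th
   term but not on the next one. *)
Lemma chain_alg_indep X m Z : irreducible_chain X m Z ->
  exists f : 'I_m -> E -> K, (forall i, polyfun (f i)) /\ alg_indep_on (Z m) f.
Proof.
elim: m => [|m IH] [chZ incZ].
  exists (fun _ _ => 0); split=> [[]//|P P0].
  have [z Zz] := (chZ 0%N (leqnn _)).2.1; have := P0 z Zz.
  by rewrite (nvar0_mpolyC P) mevalC => ->.
have [|f [pf indf]] := IH.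
  by split=> i im; [apply: chZ; apply: leqW|apply: incZ; apply: leqW].
have [[F _ ZF] irr] := chZ m.+1 (leqnn _).
have subX : Z m.+1 `<=` X by rewrite ZF; apply: subIsetl.
have [g [pg g0 gn]] := closed_in_separate (chZ m (leqnSn _)).1 subX (incZ m (ltnSn _)).
exists (fun i => oapp f g (unlift ord_max i)); split.
  by move=> i; case: unlift.
by apply: (alg_indep_extend irr _ pf pg indf) => //; apply: properW; apply: incZ.
Qed.

End PolynomialFunctions.

(** * Counting monomials: an algebraic relation modulo a hypersurface *)

Section AlgebraicRelation.
Variables (K : fieldType) (n : nat).
Implicit Types (p q g : {mpoly K[n]}) (d N : nat).

(** Each exponent is bounded separately, rather than the total degree, so that the admissible
    monomials fill a box and are counted by a power. *)
Definition degrees_le d p : Prop := forall m, m \in msupp p -> forall i, (m i <= d)%N.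

Lemma degrees_leW d d' p : (d <= d')%N -> degrees_le d p -> degrees_le d' p.
Proof. by move=> dd pd m /pd mP i; apply: leq_trans (mP i) dd. Qed.

Lemma degrees_le_ex p : exists d, degrees_le d p.
Proof.
exists (\max_(m <- msupp p) \max_i m i)%N => m mp i.
apply: leq_trans (leq_bigmax i) _.
exact: (@leq_bigmax_seq _ _ xpredT (fun m : 'X_{1..n} => \max_i m i)%N m mp).
Qed.

Lemma degrees_leM d d' p q :
  degrees_le d p -> degrees_le d' q -> degrees_le (d + d') (p * q).
Proof.
move=> pd qd m /msuppM_le/allpairsP[[m1 m2] /= [/pd m1P /qd m2P ->]] i.
by rewrite mnmDE leq_add.
Qed.

Lemma degrees_le1 : degrees_le 0 1.
Proof. by move=> m; rewrite msupp1 inE => /eqP -> i; rewrite mnm0E. Qed.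

Lemma degrees_leX d k p : degrees_le d p -> degrees_le (k * d) (p ^+ k).
Proof.
move=> pd; elim: k => [|k IH]; first exact: degrees_le1.
by rewrite exprS mulSn; apply: degrees_leM.
Qed.

Lemma degrees_le_prod k d (F : 'I_k -> {mpoly K[n]}) :
  (forall i, degrees_le d (F i)) -> degrees_le (k * d) (\prod_i F i).
Proof.
elim: k F => [|k IH] F Fd; first by rewrite big_ord0; apply: degrees_le1.
by rewrite big_ord_recl mulSn; apply: degrees_leM => //; apply: IH.
Qed.

Definition box_mnm k D (a : {ffun 'I_k -> 'I_D}) : 'X_{1..k} := [multinom a i : nat | i < k].

Lemma box_mnm_inj k D : injective (@box_mnm k D).
Proof.
by move=> a b /mnmP ab; apply/ffunP => i; apply: val_inj; have := ab i; rewrite !mnmE.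
Qed.

Lemma mcoeff_box k D (c : {ffun 'I_k -> 'I_D} -> K) b :
  (\sum_a c a *: 'X_[box_mnm a])@_(box_mnm b) = c b.
Proof.
rewrite raddf_sum (bigD1 b) //= mcoeffZ mcoeffX eqxx mulr1 big1 ?addr0// => a ab.
by rewrite mcoeffZ mcoeffX (inj_eq (@box_mnm_inj k D)) (negPf ab) mulr0.
Qed.

Lemma degrees_le_dependence (I : finType) (G : I -> {mpoly K[n]}) N :
  (forall i, degrees_le N (G i)) -> (N.+1 ^ n < #|I|)%N ->
  exists c : I -> K, (exists i, c i != 0) /\ \sum_i c i *: G i = 0.
Proof.
move=> GN cardI; pose B := {ffun 'I_n -> 'I_N.+1}.
pose A := \matrix_(i < #|I|, j < #|{: B}|) (G (enum_val i))@_(box_mnm (enum_val j)).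
have : kermx A != 0.
  rewrite -mxrank_eq0 mxrank_ker subn_eq0 -ltnNge.
  by apply: leq_ltn_trans (rank_leq_col A) _; rewrite card_ffun !card_ord.
case/rowV0Pn => v /sub_kermxP vA /rV0Pn[i vi].
exists (fun j => v 0 (enum_rank j)); split.
  by exists (enum_val i); rewrite enum_valK.
apply/mpolyP => m; rewrite mcoeff0 raddf_sum /=.
have [mN|mN] := boolP [forall i, (m i < N.+1)%N]; last first.
  rewrite big1// => j _; rewrite mcoeffZ memN_msupp_eq0 ?mulr0//.
  by apply: contra mN => /GN mG; apply/forallP.
pose a : B := [ffun i => inord (m i)].
have aE : box_mnm a = m.
  apply/mnmP => j; rewrite mnmE ffunE inordK//.
  by move/forallP: mN.
have := congr1 (fun M : 'rV__ => M 0 (enum_rank a)) vA.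
rewrite !mxE => vA0; rewrite -[RHS]vA0 (reindex _ (onW_bij _ (@enum_val_bij I))) /=.
by apply: eq_bigr => j _; rewrite mcoeffZ mxE enum_valK enum_rankK aE.
Qed.

(** A discrete mean value estimate: enlarging the side of a box by a constant adds a number of
    monomials of one order lower. *)
Lemma leq_expDn M e k : ((M + e) ^ k.+1 <= M ^ k.+1 + k.+1 * e * (M + e) ^ k)%N.
Proof.
elim: k => [|k IH]; first by rewrite !expn1 expn0 mul1n muln1.
rewrite expnS mulnDl; apply: leq_trans (leq_add (leq_mul (leqnn M) IH) (leqnn _)) _.
rewrite mulnDr -expnS -addnA leq_add2l [(k.+2 * e)%N]mulSn mulnDl addnC leq_add2l.
by rewrite mulnCA leq_mul2l [((M + e) ^ k.+1)%N]expnS leq_mul2r leq_addr !orbT.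
Qed.

(* Monomials in f of degree < D in each variable, together with the multiples
   of g by monomials, outnumber the monomials available to contain them: the
   former contribute D^n, and the quotient by g is of size O(D^(n-1)). *)
Lemma algebraic_relation_mod g (f : 'I_n -> {mpoly K[n]}) : g != 0 -> (0 < n)%N ->
  exists (P h : {mpoly K[n]}), P != 0 /\ P \mPo [tuple f i | i < n] = g * h.
Proof.
move=> g0 n0.
have [c fc] : exists c, forall i, degrees_le c (f i).
  have [c cP] := choice (fun i => degrees_le_ex (f i)).
  by exists (\max_i c i)%N => i; apply: degrees_leW _ (cP i); apply: leq_bigmax.
have [e ge] := degrees_le_ex g.
(* A product of powers of the [f i] with exponents below [D] has exponents at most [k * D]. The box
   of side M + e + 1, for M = k D, exceeds the box of side M by at most n (e+1) (M+e+1)^(n-1), hence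
   by at most n (e+1) (k+e+1)^(n-1) D^(n-1); [D] is chosen so that this is less than D^n. *)
pose k := (n * c)%N; pose D := (n * e.+1 * (k + e.+1) ^ n.-1).+1.
pose M := (k * D)%N.
pose G (s : {ffun 'I_n -> 'I_D} + {ffun 'I_n -> 'I_M}) :=
  match s with
  | inl a => \prod_i f i ^+ a i
  | inr b => g * 'X_[box_mnm b]
  end.
have GN s : degrees_le (M + e) (G s).
  case: s => [a|b] /=.
    apply: (@degrees_leW (n * (D * c))).
      by rewrite /M /k -mulnA [(c * D)%N]mulnC leq_addr.
    apply: degrees_le_prod => i; apply: degrees_leW _ (degrees_leX (fc i)).
    by rewrite leq_mul2r ltnW ?orbT.
  rewrite addnC; apply: degrees_leM => // m; rewrite msuppX inE => /eqP -> i.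
  by rewrite mnmE ltnW.
have cardlt : ((M + e).+1 ^ n < #|{: {ffun 'I_n -> 'I_D} + {ffun 'I_n -> 'I_M}}|)%N.
  rewrite card_sum !card_ffun !card_ord -addnS -(prednK n0).
  apply: leq_ltn_trans (leq_expDn _ _ _) _; rewrite addnC ltn_add2r prednK//.
  rewrite -[X in (_ < D ^ X)%N](prednK n0) expnS.
  apply: (@leq_ltn_trans (n * e.+1 * ((k + e.+1) ^ n.-1 * D ^ n.-1))).
    rewrite leq_mul2l -expnMn; apply/orP; right; case: n.-1 => // r;
      rewrite leq_exp2r// mulnDl leq_add2l.
    by rewrite -{1}[e.+1]muln1 leq_mul2l.
  by rewrite mulnA ltn_pmul2r ?expn_gt0// /D ltnS.
have [C [[s Cs] sum0]] := degrees_le_dependence GN cardlt.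
pose P := \sum_a C (inl a) *: 'X_[box_mnm a].
pose h := \sum_b C (inr b) *: 'X_[box_mnm b].
have rel : P \mPo [tuple f i | i < n] = g * - h.
  apply/eqP; rewrite mulrN -addr_eq0; apply/eqP; rewrite -[RHS]sum0 big_sumType /=.
  rewrite /P raddf_sum /h mulr_sumr; congr (_ + _); apply: eq_bigr => a _ /=.
    rewrite linearZ /= comp_mpolyX; congr (_ *: _).
    by apply: eq_bigr => i _; rewrite tnth_mktuple mnmE.
  by rewrite scalerAr.
(* A dependence among the multiples of [g] alone is impossible: it would give g h = 0, hence h = 0
   and all coefficients zero. *)
exists P, (- h); split=> //; apply/eqP => P0.
move: rel; rewrite P0 comp_mpoly0 => /esym/eqP.
rewrite mulf_eq0 (negPf g0) oppr_eq0 /= => /eqP h0; case/eqP: Cs; case: s => [a|b].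
  by rewrite -(mcoeff_box (fun a => C (inl a))) -/P P0 mcoeff0.
by rewrite -(mcoeff_box (fun a => C (inr a))) -/h h0 mcoeff0.
Qed.

End AlgebraicRelation.

(** * The dimension bound from local parametrizations by hypersurfaces *)

Section UpperBound.
Variables (K : numFieldType).

(** The inequation [h x != 0] describes a Zariski neighbourhood of [z]. The map [phi] only has to
    reach the points of [X] in it; it may send other points of the hypersurface outside [X]. *)
Definition covered_near (E : vectType K) n (X : set E) (z : E) : Prop :=
  exists h : E -> K, [/\ polyfun h, h z != 0 &
    exists (g : {mpoly K[n.+1]}) (phi : ('I_n.+1 -> K) -> E),
      [/\ g != 0, regular_map 1 phi &
        forall x, X x -> h x != 0 -> exists2 y, g.@[y] = 0 & phi y = x]].

(** A longer chain gives n+1 independent functions on its term of index n+1. Pulled back along the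
    chart they are polynomials in n+1 variables, so some nonzero polynomial in them is divisible by
    [g]. This gives a relation near one point of the term, and irreducibility extends it to the
    whole term. *)
Lemma covered_dim_le (E : vectType K) n (X : set E) m Z :
  (forall z, X z -> covered_near n X z) -> irreducible_chain X m Z -> (m <= n)%N.
Proof.
move=> cov [chZ incZ]; rewrite leqNgt; apply/negP => nm.
have chain : irreducible_chain X n.+1 Z.
  split=> i im; first by apply: chZ; apply: leq_trans im nm.
  by apply: incZ; apply: leq_trans im nm.
have [[F _ ZF] irr] := chZ _ nm.
have subX z : Z n.+1 z -> X z by rewrite ZF => -[].
have [z Zz] := irr.1.
have [h [ph hz [g [phi [g0 rphi hphi]]]]] := cov _ (subX _ Zz).
have [f [pf indf]] := chain_alg_indep chain.
have [p pE] := choice (fun i => regular1P (rphi _ (pf i))).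
have [P [r [/eqP P0 rel]]] := algebraic_relation_mod p g0 (ltn0Sn n).
have Pf0 x : X x -> h x != 0 -> P.@[fun i => f i x] = 0.
  move=> Xx hx; have [y gy <-] := hphi x Xx hx.
  have /(congr1 (meval y)) := rel; rewrite mevalM gy mul0r comp_mpoly_meval => <-.
  by apply: meval_eq => i; rewrite tnth_mktuple pE.
apply: P0; apply: indf.
have pP : polyfun (fun x => P.@[fun i => f i x]).
  exact: (algebra_meval (polyfun_algebra E)).
have [||H] := irreducible_mul irr ph pP.
- move=> x Zx; have [->|hx] := eqVneq (h x) 0; first by rewrite mul0r.
  by rewrite Pf0 ?mulr0//; apply: subX.
- by move=> /(_ z Zz) hz0; rewrite hz0 eqxx in hz.
- exact: H.
Qed.

(** Allows a point to be put in a normal form by transposition or conjugation before a chart is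
    chosen. *)
Lemma covered_near_pullback (E E' : vectType K) n (X : set E) (Y : set E')
    (t : {linear E -> E'}) (t' : {linear E' -> E}) z :
  cancel t t' -> (forall x, X x -> Y (t x)) ->
  covered_near n Y (t z) -> covered_near n X z.
Proof.
have polyfun_comp (F F' : vectType K) (s : {linear F -> F'}) f :
    polyfun f -> polyfun (f \o s).
  move=> [p pE]; rewrite (_ : f \o s = fun x => p.@[fun i => v2r (s x) 0 i]).
    apply: (algebra_meval (polyfun_algebra F)) => i.
    pose c (x : F) : K^o := v2r (s x) 0 i.
    have c_lin : linear c by move=> a x y; rewrite /c !linearP !mxE.
    pose cL := GRing.isLinear.Build _ _ _ _ c c_lin.
    pose cl : {linear F -> K^o} := HB.pack c cL.
    exact: (polyfun_linear cl).
  by apply/funext => x; rewrite /= pE.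
move=> tK XY [h [ph hz [g [phi [g0 rphi hphi]]]]].
exists (h \o t); split=> //; first exact: polyfun_comp.
exists g, (t' \o phi); split=> // [f pf|x Xx hx].
  by apply: (rphi (f \o t')); apply: polyfun_comp.
by have [y gy yx] := hphi (t x) (XY x Xx) hx; exists y; rewrite //= yx.
Qed.

End UpperBound.

(** * Lower bounds on the Krull dimension *)

Section LowerBound.
Variables (K : numFieldType) (E : vectType K) (n : nat).
Variables (X : set E) (q : {mpoly K[n]}) (phi : ('I_n -> K) -> E) (x0 : 'I_n -> K).

Definition coord_flat (i : nat) : set ('I_n -> K) :=
  [set x | forall k : 'I_n, (i <= k)%N -> x k = x0 k].

Lemma coord_flat_mul i (p p' : {mpoly K[n]}) :
  (exists2 x, coord_flat i x & p.@[x] != 0) ->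
  (exists2 x, coord_flat i x & p'.@[x] != 0) ->
  exists2 x, coord_flat i x & p.@[x] != 0 /\ p'.@[x] != 0.
Proof.
move=> [x Lx px] [y Ly py].
pose l := [tuple (if (k < i)%N then 'X_k else (x0 k)%:MP : {mpoly K[n]}) | k < n].
pose w (v : 'I_n -> K) := fun k : 'I_n => if (k < i)%N then v k else x0 k.
have restrict r v : (r \mPo l).@[v] = r.@[w v].
  rewrite comp_mpoly_meval; apply: meval_eq => k; rewrite tnth_mktuple /w.
  by case: ifP => _; rewrite ?mevalXU ?mevalC.
have wL v : coord_flat i v -> w v = v.
  move=> Lv; apply/funext => k; rewrite /w; case: ltnP => // ik.
  by rewrite Lv.
have neq0 r v : coord_flat i v -> r.@[v] != 0 -> r \mPo l != 0.
  by move=> Lv; apply: contraNneq => r0; rewrite -(wL _ Lv) -restrict r0 meval0.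
have /mpoly_neq0_meval[v] : (p \mPo l) * (p' \mPo l) != 0.
  by apply: mulf_neq0; [apply: neq0 px|apply: neq0 py].
rewrite mevalM !restrict mulf_eq0 negb_or => /andP[pv p'v].
by exists (w v); rewrite ?p'v//= => k ik; rewrite /w ltnNge ik.
Qed.

Definition flat_closure (i : nat) : set E :=
  [set u | X u /\ forall f, polyfun f ->
    (forall x, coord_flat i x -> q.@[x] != 0 -> f (phi x) = 0) -> f u = 0].

Hypotheses (rphi : regular_map q phi) (Xphi : forall x, q.@[x] != 0 -> X (phi x)).
Hypothesis qx0 : q.@[x0] != 0.

Lemma flat_closure_closed i : zariski_closed_in X (flat_closure i).
Proof.
pose P := [set f : E -> K | polyfun f /\
  forall x, coord_flat i x -> q.@[x] != 0 -> f (phi x) = 0].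
exists [set u | forall f, P f -> f u = 0].
  by apply: zariski_closed_zeros => f [].
apply/seteqP; split=> [u [Xu H]|u [Xu H]]; split=> // f.
  by case=> pf f0; apply: H.
by move=> pf f0; apply: H.
Qed.

Lemma flat_closure_in i x : coord_flat i x -> q.@[x] != 0 -> flat_closure i (phi x).
Proof. by move=> Lx qx; split=> [|f pf]; [apply: Xphi|apply]. Qed.

Lemma flat_closure_irreducible i : zariski_irreducible (flat_closure i).
Proof.
split; first by exists (phi x0); apply: flat_closure_in.
(* A closed set that does not contain the closure is avoided by the image of a nonempty open part of
   the flat. Two such parts have a common point, whose image lies in neither closed set. *)
have separate (P : set {mpoly K[dim E]}) :
    let F := [set u : E | forall p, P p -> p.@[fun j => v2r u 0 j] = 0] in
    ~ (flat_closure i `<=` F) ->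
    exists r : {mpoly K[n]}, (exists2 x, coord_flat i x & r.@[x] != 0) /\
      forall x, r.@[x] != 0 -> q.@[x] != 0 /\ ~ F (phi x).
  move=> F /existsNP[u /not_implyP[[Xu uP] /existsNP[p /not_implyP[Pp pu]]]].
  pose f u := p.@[fun j => v2r u 0 j].
  have pf : polyfun f by exists p.
  have [N [r rE]] := rphi pf.
  have {}uP : exists2 x, coord_flat i x & q.@[x] != 0 /\ f (phi x) != 0.
    apply: contrapT => H; apply: pu; apply: (uP f) => // x Lx qx.
    by apply/eqP/negPn/negP => fx; apply: H; exists x.
  exists (r * q); split=> [|x].
    case: uP => x Lx [qx fx]; exists x => //.
    by rewrite mevalM -rE// !mulf_neq0// expf_neq0.
  rewrite mevalM mulf_eq0 negb_or => /andP[rx qx]; split=> // /(_ p Pp) fx.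
  by move: rx; rewrite -rE// /f fx mul0r eqxx.
move=> F G [P ->] [P' ->] sub; apply: contrapT => /not_orP[/separate + /separate].
move=> [r [rx rP]] [r' [rx' rP']].
have [w Lw [/rP[qw Fw] /rP'[_ Gw]]] := coord_flat_mul rx rx'.
by case: (sub (phi w) (flat_closure_in Lw qw)).
Qed.

(* The chain consists of the closures in X of the images of a full flag of
   coordinate flats through x0; F separates two consecutive ones. *)
Lemma chain_of_chart :
  (forall i : 'I_n, exists F f, [/\ polyfun F, regular 1 f,
    forall x, coord_flat i x -> q.@[x] != 0 -> F (phi x) = 0,
    forall x, q.@[x] != 0 -> f x != 0 -> F (phi x) != 0 &
    exists2 x, coord_flat i.+1 x & f x != 0]) ->
  exists Z, irreducible_chain X n Z.
Proof.
move=> H; exists flat_closure; split=> [i _|i lt_in].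
  by split; [apply: flat_closure_closed|apply: flat_closure_irreducible].
split=> [u [Xu uP]|sub].
  split=> // f pf f0; apply: uP => // x Lx; apply: f0 => k ik.
  exact/Lx/ltnW.
have [F [f [pF /regular1P[r rE] F0 Fn [x Lx fx]]]] := H (Ordinal lt_in).
(* The point where [f] is nonzero may lie outside the domain of [phi]; irreducibility of the flat
   supplies one where [q] is nonzero as well. *)
have [||w Lw [qw]] := @coord_flat_mul i.+1 q r.
- by exists x0.
- by exists x; rewrite // -rE.
rewrite -rE => fw; have [_ wP] := sub _ (flat_closure_in Lw qw).
by have /eqP := Fn w qw fw; apply; apply: wP.
Qed.

End LowerBound.

(** * Reflections *)

Section MatrixValuedMaps.
Variable K : numFieldType.

Lemma polyfun_of_linear (E : vectType K) (f : E -> K^o) : linear f -> @polyfun K E f.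
Proof.
move=> f_lin; pose fL := GRing.isLinear.Build _ _ _ _ f f_lin.
pose fl : {linear E -> K^o} := HB.pack f fL; exact: (polyfun_linear fl).
Qed.

Lemma polyfun_mx m n : mx_algebra (@polyfun K _) (fun M : 'M[K]_(m, n) => M).
Proof.
by move=> i j; apply: polyfun_of_linear => a x y; rewrite !mxE.
Qed.

Lemma polyfun_quadruple n j : mx_algebra (@polyfun K _) (fun M : quadruple K n => M j).
Proof.
by move=> a b; apply: polyfun_of_linear => c x y; rewrite !ffunE !mxE.
Qed.

(** Regularity is defined through the coordinates [v2r]. Expanding a map on fixed vectors, such as
    matrix units, reduces it to scalar coefficients without knowing how [v2r] orders the entries. *)
Lemma regular_map_sum (E : vectType K) (I : finType) n (q : {mpoly K[n]})
    (c : I -> ('I_n -> K) -> K) (e : I -> E) :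
  (forall i, regular q (c i)) -> regular_map q (fun x => \sum_i c i x *: e i).
Proof.
move=> rc; apply: regular_mapP => j.
under eq_fun do rewrite linear_sum summxE.
apply: (algebra_sum (regular_algebra q)) => i.
under eq_fun do rewrite linearZ mxE.
apply: (algebraM (regular_algebra q)) => //.
exact: (algebra_cst (regular_algebra q)).
Qed.

Lemma regular_map_mx m1 m2 n (q : {mpoly K[n]}) (phi : ('I_n -> K) -> 'M[K]_(m1, m2)) :
  mx_algebra (regular q) phi -> regular_map q phi.
Proof.
move=> rphi; rewrite (_ : phi = fun x => \sum_(p : 'I_m1 * 'I_m2)
    phi x p.1 p.2 *: delta_mx p.1 p.2).
  by apply: regular_map_sum => -[i j]; apply: rphi.
by apply/funext => x; rewrite {1}(matrix_sum_delta (phi x)) pair_bigA.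
Qed.

Lemma regular_map_quadruple m n (q : {mpoly K[n]}) (phi : ('I_n -> K) -> quadruple K m) :
  (forall j, mx_algebra (regular q) (fun x => phi x j)) -> regular_map q phi.
Proof.
move=> rphi; rewrite (_ : phi = fun x => \sum_(p : 'I_4 * ('I_m * 'I_m))
    phi x p.1 p.2.1 p.2.2 *: [ffun j => (j == p.1)%:R *: delta_mx p.2.1 p.2.2]).
  by apply: regular_map_sum => -[j [a b]]; apply: rphi.
apply/funext => x; apply/ffunP => j.
rewrite sum_ffunE (eq_bigr (fun p => phi x p.1 p.2.1 p.2.2 *: ((j == p.1)%:R *: delta_mx p.2.1
  p.2.2)));
  last by move=> p _; rewrite !ffunE.
rewrite -(pair_bigA _ (fun i r => phi x i r.1 r.2 *: ((j == i)%:R *: delta_mx r.1 r.2))) /=.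
rewrite (bigD1 j) //= eqxx [X in _ + X]big1 ?addr0; last first.
  move=> i /negPf ij; apply: big1 => r _.
  by rewrite eq_sym ij scale0r scaler0.
rewrite {1}(matrix_sum_delta (phi x j)) pair_bigA /=.
by apply: eq_bigr => r _; rewrite scale1r.
Qed.

End MatrixValuedMaps.

Lemma ord3_ind (P : 'I_3 -> Prop) :
  P ord0 -> P (lift ord0 ord0) -> P (lift ord0 (lift ord0 ord0)) -> forall i, P i.
Proof.
move=> P0 P1 P2 i; case: (unliftP ord0 i) => [j ->|-> //].
by case: (unliftP ord0 j) => [k ->|-> //]; rewrite (ord1 k).
Qed.

Lemma ord2_ind (P : 'I_2 -> Prop) : P ord0 -> P (lift ord0 ord0) -> forall i, P i.
Proof.
move=> P0 P1 i; case: (unliftP ord0 i) => [j ->|-> //].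
by rewrite (ord1 j).
Qed.

(** * Reflections as rank-one perturbations of the identity *)

Section Reflections.
Variable K : fieldType.

(* A reflection with ratio x is 1 + u v for a column u and a row v with
   v u = x - 1; when the k-th entry of v is 1, the other entries of v and u are
   free coordinates. *)
Definition unit_row n (k : 'I_n.+1) (y : 'I_n -> K) : 'rV[K]_n.+1 :=
  \row_l oapp y 1 (unlift k l).

Definition dual_col n (k : 'I_n.+1) (x : K) (y s : 'I_n -> K) : 'cV[K]_n.+1 :=
  \col_l oapp s (x - 1 - \sum_i y i * s i) (unlift k l).

Lemma unit_row_dual n (k : 'I_n.+1) x y s :
  unit_row k y *m dual_col k x y s = (x - 1)%:M.
Proof.
rewrite [LHS]mx11_scalar; congr _%:M; rewrite mxE (bigD1_ord k) //= !mxE unlift_none mul1r /=.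
rewrite [X in _ + X](eq_bigr (fun i => y i * s i)) ?subrK// => i _.
by rewrite !mxE liftK.
Qed.

Lemma unit_row_dualP n (k : 'I_n.+1) x (u : 'cV[K]_n.+1) (v : 'rV[K]_n.+1) :
  v 0 k = 1 -> v *m u = (x - 1)%:M ->
  v = unit_row k (fun i => v 0 (lift k i)) /\
  u = dual_col k x (fun i => v 0 (lift k i)) (fun i => u (lift k i) 0).
Proof.
move=> vk vu; split.
  by apply/rowP => l; rewrite mxE; case: (unliftP k l) => [j|] ->; rewrite /= ?vk.
apply/colP => l; rewrite mxE; case: (unliftP k l) => [j|] -> //=.
have /(congr1 (fun M : 'M__ => M 0 0)) := vu.
by rewrite !mxE (bigD1_ord k) //= vk mul1r ?mulr1n => <-; rewrite addrK.
Qed.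

Lemma unit_row_lead n (k : 'I_n.+1) y : unit_row k y 0 k = 1.
Proof. by rewrite mxE unlift_none. Qed.

Lemma rank1_normalize m n (k : 'I_n) x (u : 'M[K]_(m, 1)) (w : 'M[K]_(n, m)) (v : 'rV[K]_n) :
  v 0 k != 0 -> v *m (w *m u) = x%:M ->
  exists (u' : 'M_(m, 1)) (v' : 'rV_n),
    [/\ v' 0 k = 1, v' *m (w *m u') = x%:M & u' *m v' = u *m v].
Proof.
move=> vk vu; exists (v 0 k *: u), ((v 0 k)^-1 *: v); split.
- by rewrite mxE mulVf.
- by rewrite -!scalemxAr -scalemxAl scalerA mulfV// scale1r.
- by rewrite -scalemxAr -scalemxAl scalerA mulVf// scale1r.
Qed.

Lemma rank1_neq0 n a (u : 'cV[K]_n) (v : 'rV[K]_n) :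
  a != 1 -> v *m u = (a - 1)%:M -> u != 0 /\ v != 0.
Proof.
move=> a1 /(congr1 (fun N : 'M__ => N 0 0)); rewrite [RHS]mxE eqxx mulr1n => vu.
have {}vu : (v *m u) 0 0 != 0 by rewrite vu subr_eq0.
by split; apply: contraNneq vu => ->; rewrite ?(mulmx0, mul0mx) mxE.
Qed.

Lemma inord_neq n (a b : nat) : (a < n.+1)%N -> (b < n.+1)%N -> a != b ->
  (inord a : 'I_n.+1) != inord b.
Proof. by move=> an bn; apply: contra => /eqP/(congr1 val); rewrite /= !inordK// => ->. Qed.

Lemma reflection_classW (x : K) M : reflection_class x M ->
  exists (u : 'cV_3) (v : 'rV_3), v *m u = (x - 1)%:M /\ M = 1%:M + u *m v.
Proof.
move=> [P Pu ->]; exists ((x - 1) *: (P *m delta_mx 0 0)), (delta_mx 0 0 *m invmx P).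
split.
  rewrite -scalemxAr mulmxA mulmxKV// mul_delta_mx.
  by rewrite [LHS]mx11_scalar !mxE eqxx mulr1.
have E : P *m (delta_mx 0 0 : 'cV_3) *m ((delta_mx 0 0 : 'rV_3) *m invmx P) =
    P *m delta_mx 0 0 *m invmx P.
  by rewrite mulmxA -(mulmxA P) mul_delta_mx.
rewrite -[in RHS](mulmxV Pu) -scalemxAl E.
rewrite scalemxAl scalemxAr -mulmxDl; congr (_ *m _).
rewrite -{2}[P]mulmx1 -mulmxDr; congr (_ *m _).
apply/matrixP => i j; rewrite !mxE.
by elim/ord3_ind: i; elim/ord3_ind: j => /=; ring.
Qed.

Lemma reflection_classI (x : K) (u : 'cV[K]_3) (v : 'rV[K]_3) : x != 1 ->
  v 0 0 = 1 -> v *m u = (x - 1)%:M -> reflection_class x (1%:M + u *m v).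
Proof.
move=> x1 v0 /(congr1 (fun M : 'M__ => M 0 0)) vu.
have {x1} x10 : x - 1 != 0 by rewrite subr_eq0.
have {vu} u0 : u 0 0 = x - 1 - v 0 (lift ord0 ord0) * u (lift ord0 ord0) 0
    - v 0 (lift ord0 (lift ord0 ord0)) * u (lift ord0 (lift ord0 ord0)) 0.
  move: vu; rewrite !mxE !big_ord_recl big_ord0 v0 eqxx mulr1n => <-; ring.
(* The columns of [P] are [u], an eigenvector for [x], and a basis of the kernel of [v], which 1 + u
   v fixes pointwise; [Q] is the inverse of [P]. *)
pose P : 'M[K]_3 := \matrix_(i, j)
  if j == 0 then u i 0 else if i == 0 then - v 0 j else (i == j)%:R.
pose Q : 'M[K]_3 := \matrix_(i, j)
  if i == 0 then v 0 j / (x - 1) else (i == j)%:R - u i 0 * v 0 j / (x - 1).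
have PQ : P *m Q = 1%:M.
  apply/matrixP => i j; rewrite !mxE !big_ord_recl big_ord0 !mxE.
  by elim/ord3_ind: i; elim/ord3_ind: j => /=; rewrite ?v0 ?u0; field.
have Pu := (mulmx1_unit PQ).1.
exists P => //; apply: (can_inj (mulmxK Pu)); rewrite mulmxKV//.
apply/matrixP => i j; rewrite !mxE !big_ord_recl big_ord0 !mxE.
rewrite !big_ord_recl !big_ord0.
by elim/ord3_ind: i; elim/ord3_ind: j => /=; rewrite ?v0 ?u0; ring.
Qed.

End Reflections.

(** * The dimension of the class of a reflection *)

Section ReflectionCharts.
Variable K : numFieldType.

Lemma unit_row_algebra T (A : set (T -> K)) n k (y : 'I_n -> T -> K) :
  fun_algebra A -> (forall i, A (y i)) ->
  mx_algebra A (fun w => unit_row k (fun i => y i w)).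
Proof.
move=> algA Ay i j; under eq_fun do rewrite mxE.
by case: unlift => [l|] /=; [apply: Ay|apply: (algebra_cst algA)].
Qed.

Lemma dual_col_algebra T (A : set (T -> K)) n k x (y s : 'I_n -> T -> K) :
  fun_algebra A -> (forall i, A (y i)) -> (forall i, A (s i)) ->
  mx_algebra A (fun w => dual_col k x (fun i => y i w) (fun i => s i w)).
Proof.
move=> algA Ay As i j; under eq_fun do rewrite mxE.
case: unlift => [l|] /=; first exact: As.
apply: (algebraB algA); first exact: (algebra_cst algA).
by apply: (algebra_sum algA) => l; apply: (algebraM algA).
Qed.

Lemma mpolyXU_neq0 n (i : 'I_n) : 'X_i != 0 :> {mpoly K[n]}.
Proof.
apply/eqP => /(congr1 (meval (fun=> 1))).
by rewrite mevalXU meval0; apply/eqP/oner_neq0.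
Qed.

Lemma chart_entry_col n x (y s : 'I_n -> K) i :
  (1%:M + dual_col 0 x y s *m unit_row 0 y) (lift 0 i) 0 = s i.
Proof.
by rewrite !mxE big_ord1 !mxE liftK unlift_none /= mulr1 add0r.
Qed.

Lemma chart_entry_row n x (y s : 'I_n -> K) i :
  (1%:M + dual_col 0 x y s *m unit_row 0 y) 0 (lift 0 i) =
  (x - 1 - \sum_l y l * s l) * y i.
Proof.
by rewrite !mxE big_ord1 !mxE liftK unlift_none /= add0r.
Qed.

(** Coordinates 0 and 1 are the free entries of the column, 2 and 3 those of the row. The number of
    variables is left open: four for the lower bound, and for the upper bound a fifth, dummy one
    whose vanishing is the equation of the hypersurface. *)
Definition class_chart (x : K) k n (w : 'I_n.+1 -> K) : 'M[K]_3 :=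
  let y := fun i : 'I_2 => w (inord (2 + i)) in
  1%:M + dual_col k x y (fun i => w (inord i)) *m unit_row k y.

Lemma class_chart_regular x k n (q : {mpoly K[n.+1]}) :
  regular_map q (@class_chart x k n).
Proof.
have alg := regular_algebra q.
apply: regular_map_mx; apply: (mx_algebraD alg); first exact: (mx_algebra_cst alg).
apply: (mx_algebraM alg).
  by apply: dual_col_algebra => // i; apply: regular_coord.
by apply: unit_row_algebra => // i; apply: regular_coord.
Qed.

Lemma reflection_class_covered (x : K) z : x != 1 ->
  reflection_class x z -> covered_near 4 (reflection_class x) z.
Proof.
move=> x1 /reflection_classW[u [v [vu zE]]].
(* The matrix z - 1 has trace x - 1, which is nonzero, hence a nonzero diagonal entry. Where this
   entry stays nonzero, the row of the reflection can be scaled to have k-th entry 1. *)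
have [k zk] : exists k, (z - 1%:M) k k != 0.
  have tr0 : \tr (z - 1%:M) != 0.
    by rewrite zE addrC addKr mxtrace_mulC vu mxtrace_scalar mulr1n subr_eq0.
  apply: contrapT => H; case/negP: tr0; apply/eqP.
  apply: big1 => i _; apply/eqP/negPn/negP => zi; apply: H; by exists i.
exists (fun M => (M - 1%:M) k k); split=> //.
  have alg := @polyfun_algebra K 'M[K]_3.
  apply: (mx_algebraB alg); [exact: polyfun_mx|exact: (mx_algebra_cst alg)].
exists 'X_ord_max, (@class_chart x k 4); split.
- exact: mpolyXU_neq0.
- exact: class_chart_regular.
move=> {z zE zk vu u v} M /reflection_classW[u [v [vu ->]]].
rewrite addrC addKr => uvk.
have vk : v 0 k != 0.
  by apply: contraNneq uvk => vk; rewrite mxE big1// => i _; rewrite (ord1 i) vk mulr0.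
have [|u' [v' [v'k + <-]]] := @rank1_normalize K 3 3 k (x - 1) u 1%:M v vk;
  rewrite !mul1mx// => v'u'.
have [] := unit_row_dualP v'k v'u'.
set y := fun i => v' _ _; set s := fun i => u' _ _; move=> vE uE.
exists (fun j => [:: s ord0; s (lift ord0 ord0); y ord0; y (lift ord0 ord0); 0]`_j).
  by rewrite mevalXU.
rewrite vE uE /class_chart; congr (_ + dual_col _ _ _ _ *m unit_row _ _);
  by apply/funext; apply: ord2_ind; rewrite /= inordK.
Qed.

Lemma reflection_class_chain (x : K) : x != 1 ->
  exists Z, irreducible_chain (reflection_class x) 4 Z.
Proof.
move=> x1; pose phi := @class_chart x 0 3.
have reg i j : regular 1 (fun w => phi w i j).
  exact: (@class_chart_regular x 0 3 1 _ (@polyfun_mx K 3 3 i j)).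
apply: (@chain_of_chart K _ 4 _ 1 phi (fun=> 0)).
- exact: class_chart_regular.
- move=> w _; apply: reflection_classI => //; first exact: unit_row_lead.
  exact: unit_row_dual.
- by rewrite meval1 oner_neq0.
move=> i; pose e (k : 'I_4) : K := (k == i)%:R.
have Le : coord_flat (fun=> 0) i.+1 e.
  by move=> k ik; rewrite /e eqE /= gtn_eqF.
have [i2|i2] := ltnP i 2.
  exists (fun M : 'M[K]_3 => M (lift ord0 (Ordinal i2)) 0),
    (fun w => phi w (lift ord0 (Ordinal i2)) 0).
  have iE : inord i = i :> 'I_4 by rewrite inord_val.
  split=> // [|w Lw _|]; first exact: polyfun_mx.
    by rewrite /phi /class_chart chart_entry_col /= iE Lw.
  by exists e; rewrite // /phi /class_chart chart_entry_col /= iE /e eqxx oner_neq0.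
have i2' : (i - 2 < 2)%N by rewrite ltn_subLR.
(* This entry is a coordinate of the row times x - 1 - sum y s. At the test point [e] the
   coordinates of the column are 0, so the factor is x - 1. *)
exists (fun M : 'M[K]_3 => M 0 (lift ord0 (Ordinal i2'))),
  (fun w => phi w 0 (lift ord0 (Ordinal i2'))).
have iE : inord (2 + (i - 2)) = i :> 'I_4 by rewrite subnKC// inord_val.
split=> // [|w Lw _|]; first exact: polyfun_mx.
  by rewrite /phi /class_chart chart_entry_row [w (inord (2 + Ordinal i2'))](_ : _ = 0)
    ?mulr0// iE Lw.
exists e; rewrite // /phi /class_chart chart_entry_row /= iE /e eqxx mulr1.
rewrite big1 ?subr0 ?subr_eq0// => l _.
suff -> : (inord l == i :> 'I_4) = false by rewrite mulr0.
apply/negbTE; rewrite eqE /= inordK; last by apply: leq_trans (ltn_ord l) _.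
by rewrite ltn_eqF// (leq_trans _ i2).
Qed.

Lemma has_dim_reflection_class (x : K) : x != 1 -> has_dim (reflection_class x) 4.
Proof.
move=> x1; split; first exact: reflection_class_chain.
by move=> m Z; apply: covered_dim_le => z; apply: reflection_class_covered.
Qed.

End ReflectionCharts.

(** * Quadruples with trivial centralizer *)

Section Quads.
Variable K : fieldType.

Definition quad n (M0 M1 M2 M3 : 'M[K]_n) : quadruple K n :=
  [ffun j : 'I_4 => nth M0 [:: M0; M1; M2; M3] j].

Lemma quadE n (M0 M1 M2 M3 : 'M[K]_n) :
  ((quad M0 M1 M2 M3 (inord 0) = M0) * (quad M0 M1 M2 M3 (inord 1) = M1) *
   (quad M0 M1 M2 M3 (inord 2) = M2) * (quad M0 M1 M2 M3 (inord 3) = M3))%type.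
Proof. by rewrite !ffunE !inordK. Qed.

Lemma ord4_ind (P : 'I_4 -> Prop) :
  P (inord 0) -> P (inord 1) -> P (inord 2) -> P (inord 3) -> forall i, P i.
Proof.
by move=> P0 P1 P2 P3 i; rewrite -(inord_val i); case: i => [[|[|[|[|]]]]].
Qed.

Lemma quad_eqP n (M N : quadruple K n) :
  M (inord 0) = N (inord 0) -> M (inord 1) = N (inord 1) ->
  M (inord 2) = N (inord 2) -> M (inord 3) = N (inord 3) -> M = N.
Proof. by move=> *; apply/ffunP; apply: ord4_ind. Qed.

Lemma rep_last_eq n (M N : quadruple K n) : is_rep M -> is_rep N ->
  M (inord 0) = N (inord 0) -> M (inord 1) = N (inord 1) ->
  M (inord 2) = N (inord 2) -> M = N.
Proof.
move=> rM rN e0 e1 e2; apply: quad_eqP => //.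
have Pu := (mulmx1_unit rM).1.
by apply: (can_inj (mulKmx Pu)); rewrite rM e0 e1 e2 rN.
Qed.

Lemma reflection_mulV m n x (u : 'M[K]_(m, n)) (v : 'M_(n, m)) : x != 0 ->
  v *m u = (x - 1)%:M -> (1%:M + u *m v) *m (1%:M - x^-1 *: (u *m v)) = 1%:M.
Proof.
move=> x0 vu; rewrite mulmxDl mul1mx mulmxBr mulmx1 -scalemxAr mulmxA -(mulmxA u) vu.
rewrite mul_mx_scalar -scalemxAl scalerA mulrBr mulVf// mulr1.
by rewrite scalerBl scale1r subKr subrK.
Qed.

Lemma rep_last n x (M : quadruple K n) m (u : 'M_(n, m)) (v : 'M_(m, n)) : x != 0 ->
  v *m u = (x - 1)%:M -> M (inord 3) = 1%:M + u *m v -> is_rep M ->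
  M (inord 0) *m M (inord 1) *m M (inord 2) = 1%:M - x^-1 *: (u *m v).
Proof.
move=> x0 vu ME rM; have E := reflection_mulV x0 vu.
by rewrite -[LHS]mulmx1 -[X in _ *m X = _]E -ME mulmxA rM mul1mx.
Qed.

End Quads.

(** * Representations by reflections whose first three columns are independent *)

Section SpanCase.
Variables (K : numFieldType) (x : 'I_4 -> K).
Hypotheses (x0 : forall j, x j != 0) (x1 : forall j, x j != 1).
Let C j := reflection_class (x j).

Definition cols3 (u : 'I_4 -> 'cV[K]_3) : 'M[K]_3 := \matrix_(i,
  j) u (widen_ord (leqnSn 3) j) i 0.

Lemma cols3E (u : 'I_4 -> 'cV[K]_3) i :
  ((cols3 u i ord0 = u (inord 0) i 0) *
   (cols3 u i (lift ord0 ord0) = u (inord 1) i 0) *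
   (cols3 u i (lift ord0 (lift ord0 ord0)) = u (inord 2) i 0))%type.
Proof.
by split; [split|]; rewrite mxE; congr (u _ _ _); apply: val_inj; rewrite /= inordK.
Qed.

Lemma cols3_dual (u : 'I_4 -> 'cV[K]_3) : cols3 u \in unitmx ->
  exists r : 'I_3 -> 'rV[K]_3, forall i j, r i *m u (widen_ord (leqnSn 3) j) = (i == j)%:R%:M.
Proof.
move=> Uu; exists (fun i => row i (invmx (cols3 u))) => i j.
have -> : u (widen_ord (leqnSn 3) j) = col j (cols3 u).
  by apply/colP => l; rewrite !mxE.
by rewrite -row_mul colE mulmxA mulVmx// mul1mx [LHS]mx11_scalar !mxE eqxx andbT.
Qed.

Lemma inord_widen : ((inord 0 = widen_ord (leqnSn 3) ord0) *
  (inord 1 = widen_ord (leqnSn 3) (lift ord0 ord0)) *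
  (inord 2 = widen_ord (leqnSn 3) (lift ord0 (lift ord0 ord0))))%type.
Proof. by split; [split|]; apply: val_inj; rewrite /= inordK. Qed.

(** By the relation, M_0 M_1 M_2 - 1 is a multiple of u_3 v_3. It also equals u_0 (v_0 M_1 M_2) +
    u_1 (v_1 M_2) + u_2 v_2, and the rows dual to the u_j extract the three row factors, which are
    thus multiples of v_3. Undoing the factors M_2 and M_1 then treats v_2, v_1 and v_0 in this
    order. *)
Lemma variety_V_parallel (M : quadruple K 3) (u : 'I_4 -> 'cV[K]_3) (v : 'I_4 -> 'rV[K]_3) :
  (forall j, v j *m u j = (x j - 1)%:M) -> (forall j, M j = 1%:M + u j *m v j) ->
  is_rep M -> cols3 u \in unitmx -> forall j, (v j <= v (inord 3))%MS.
Proof.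
move=> vu ME rM /cols3_dual[r ru].
have := rep_last (x0 _) (vu (inord 3)) (ME _) rM.
set N := _ *m M (inord 2) => NE.
have Nsub (a : 'rV[K]_3) : (a *m (N - 1%:M) <= v (inord 3))%MS.
  rewrite NE addrC addKr mulmxN -scalemxAr mulmxA eqmx_opp.
  by rewrite scalemx_sub// submxMl.
have NE' : N - 1%:M = u (inord 0) *m (v (inord 0) *m M (inord 1) *m M (inord 2)) +
     u (inord 1) *m (v (inord 1) *m M (inord 2)) + u (inord 2) *m v (inord 2).
  rewrite /N {1}(ME (inord 0)) !mulmxDl !mul1mx {1}(ME (inord 1)) mulmxDl mul1mx.
  rewrite {1}(ME (inord 2)) addrC !addrA addNr add0r !mulmxA addrC.
  by rewrite [u _ *m v _ + _]addrC addrA.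
have step j : (r j *m (N - 1%:M) <= v (inord 3))%MS by [].
have s2 : (v (inord 2) <= v (inord 3))%MS.
  have := step (lift ord0 (lift ord0 ord0)).
  rewrite NE' !mulmxDr !mulmxA !inord_widen !ru /= !mul_scalar_mx !scale0r !mul0mx !add0r.
  by rewrite scale1r -!inord_widen.
have s1 : (v (inord 1) <= v (inord 3))%MS.
  have := step (lift ord0 ord0).
  rewrite NE' !mulmxDr !mulmxA !inord_widen !ru /= !mul_scalar_mx !scale0r !mul0mx add0r addr0.
  rewrite scale1r -!inord_widen => H.
  have -> : v (inord 1) = v (inord 1) *m M (inord 2) - v (inord 1) *m u (inord 2) *m v (inord
    2).
    by rewrite ME mulmxDr mulmx1 mulmxA addrK.
  by rewrite addmx_sub// eqmx_opp mulmx_sub.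
have s0 : (v (inord 0) <= v (inord 3))%MS.
  have := step ord0.
  rewrite NE' !mulmxDr !mulmxA !inord_widen !ru /= !mul_scalar_mx !scale0r !mul0mx !addr0.
  rewrite scale1r -!inord_widen => H.
  have -> : v (inord 0) = v (inord 0) *m M (inord 1) *m M (inord 2)
      - v (inord 0) *m u (inord 1) *m (v (inord 1) *m M (inord 2))
      - v (inord 0) *m u (inord 2) *m v (inord 2).
    rewrite {1}(ME (inord 1)) mulmxDr mulmx1 mulmxDl !mulmxA addrK.
    by rewrite ME mulmxDr mulmx1 mulmxA addrK.
  have H1 : (v (inord 1) *m M (inord 2) <= v (inord 3))%MS.
    by rewrite ME mulmxDr mulmx1 addmx_sub// mulmxA mulmx_sub.
  apply: addmx_sub; first apply: addmx_sub => //; rewrite eqmx_opp; exact: mulmx_sub.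
by apply: ord4_ind.
Qed.

Lemma cols3_eq0 (u : 'I_4 -> 'cV[K]_3) : cols3 u \notin unitmx ->
  exists2 r : 'rV[K]_3, r != 0 & forall j, r *m u (widen_ord (leqnSn 3) j) = 0.
Proof.
rewrite -row_free_unit -kermx_eq0 => /rowV0Pn[r /sub_kermxP ru r0]; exists r => // j.
rewrite [LHS]mx11_scalar; have /(congr1 (fun N : 'M__ => N 0 j)) := ru.
rewrite !mxE => ruj; rewrite [X in X%:M](_ : _ = 0) ?raddf0// -[RHS]ruj.
by apply: eq_bigr => i _; rewrite mxE.
Qed.

(** A row fixed by three of the matrices is fixed by the fourth, so r u_3 v_3 = 0; multiplying by
    u_3 gives (x_3 - 1) r u_3 = 0. *)
Lemma row_fixed_last (M : quadruple K 3) (u : 'I_4 -> 'cV[K]_3) (v : 'I_4 ->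
  'rV[K]_3) (r : 'rV[K]_3) :
  (forall j, v j *m u j = (x j - 1)%:M) -> (forall j, M j = 1%:M + u j *m v j) ->
  is_rep M -> (forall j, r *m u (widen_ord (leqnSn 3) j) = 0) -> forall j, r *m u j = 0.
Proof.
move=> vu ME rM ru.
have u0 : r *m u (inord 0) = 0 by rewrite inord_widen ru.
have u1 : r *m u (inord 1) = 0 by rewrite inord_widen ru.
have u2 : r *m u (inord 2) = 0 by rewrite inord_widen ru.
apply: ord4_ind => //.
have := congr1 (mulmx r) rM; rewrite mulmx1 !mulmxA.
rewrite (ME (inord 0)) mulmxDr mulmx1 mulmxA u0 mul0mx addr0.
rewrite (ME (inord 1)) mulmxDr mulmx1 mulmxA u1 mul0mx addr0.
rewrite (ME (inord 2)) mulmxDr mulmx1 mulmxA u2 mul0mx addr0.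
rewrite (ME (inord 3)) mulmxDr mulmx1 mulmxA -[RHS]addr0 => /addrI E.
have := congr1 (fun N => N *m u (inord 3)) E.
rewrite -mulmxA vu mul0mx mul_mx_scalar => /eqP; rewrite scaler_eq0 subr_eq0 (negPf (x1 _)).
by move/eqP.
Qed.

End SpanCase.

Section SpanChart.
Variables (K : numFieldType) (x : 'I_4 -> K).
Hypotheses (x0 : forall j, x j != 0) (x1 : forall j, x j != 1).
Let C j := reflection_class (x j).

Lemma variety_V_frame M : variety_V C M -> exists u v,
  (forall j, v j *m u j = (x j - 1)%:M :> 'M_1) /\ (forall j, M j = 1%:M + u j *m v j).
Proof.
move=> [CM _]; have [u uP] := choice (fun j => reflection_classW (CM j)).
have [v vP] := choice uP.
by exists u, v; split=> j; have [] := vP j.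
Qed.

(** [V j] inverts the j-th reflection, so the last matrix is the one forced by the relation. That it
    is a reflection is shown in [span_quad_T]. *)
Definition span_quad k (y : 'I_2 -> K) (s : 'I_4 -> 'I_2 -> K) : quadruple K 3 :=
  let X j := dual_col k (x j) y (s j) *m unit_row k y in
  let V j := 1%:M - (x j)^-1 *: X j in
  quad (1%:M + X (inord 0)) (1%:M + X (inord 1)) (1%:M + X (inord 2))
    (V (inord 2) *m V (inord 1) *m V (inord 0)).

Lemma span_quad_rep k y s : is_rep (span_quad k y s).
Proof.
rewrite /is_rep !quadE !mulmxA;
  have E j := reflection_mulV (x0 j) (unit_row_dual k (x j) y (s j)).
by rewrite -(mulmxA _ _ (_ - (x (inord 2))^-1 *: _)) E mulmx1
  -(mulmxA _ _ (_ - (x (inord 1))^-1 *: _)) E mulmx1 E.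
Qed.

Definition span_chart k n (w : 'I_n.+1 -> K) : quadruple K 3 :=
  span_quad k (fun i => w (inord (6 + i))) (fun j i => w (inord (2 * j + i))).

Lemma span_chart_regular k n (q : {mpoly K[n.+1]}) : regular_map q (@span_chart k n).
Proof.
have alg := regular_algebra q.
have one : mx_algebra (regular q) (fun=> 1%:M : 'M[K]_3) by exact: (mx_algebra_cst alg).
have X j : mx_algebra (regular q) (fun w : 'I_n.+1 -> K => dual_col k (x j)
    (fun i : 'I_2 => w (inord (6 + i))) (fun i : 'I_2 => w (inord (2 * j + i)))
    *m unit_row k (fun i : 'I_2 => w (inord (6 + i)))).
  apply: (mx_algebraM alg).
    by apply: dual_col_algebra => // i; apply: regular_coord.
  by apply: unit_row_algebra => // i; apply: regular_coord.
have V j : mx_algebra (regular q) (fun w : 'I_n.+1 -> K => 1%:M - (x j)^-1 *: (dual_col k (x j)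
    (fun i : 'I_2 => w (inord (6 + i))) (fun i : 'I_2 => w (inord (2 * j + i)))
    *m unit_row k (fun i : 'I_2 => w (inord (6 + i))))).
  apply: (mx_algebraB alg) => //; apply: (mx_algebraZ alg) => //.
  exact: (algebra_cst alg).
apply: regular_map_quadruple; apply: ord4_ind;
  under eq_fun do rewrite /span_chart /span_quad quadE.
- exact: (mx_algebraD alg).
- exact: (mx_algebraD alg).
- exact: (mx_algebraD alg).
- by do 2![apply: (mx_algebraM alg) => //].
Qed.

Lemma variety_V_span_covered z u v : variety_V C z ->
  (forall j, v j *m u j = (x j - 1)%:M :> 'M_1) -> (forall j, z j = 1%:M + u j *m v j) ->
  cols3 u \in unitmx -> covered_near 8 (variety_V C) z.
Proof.
have colsZ (a : 'I_4 -> K) (u' : 'I_4 -> 'cV[K]_3) : \det (cols3 (fun j => a j *: u' j)) =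
    \det (cols3 u') * \prod_(i < 3) a (widen_ord (leqnSn 3) i).
  have -> : cols3 (fun j => a j *: u' j) =
      cols3 u' *m diag_mx (\row_i a (widen_ord (leqnSn 3) i)).
    by rewrite mul_mx_diag; apply/matrixP => i j; rewrite !mxE mulrC.
  by rewrite det_mulmx det_diag; congr (_ * _); apply: eq_bigr => i _; rewrite mxE.
(* The k-th column of M_j - 1 is u_j times the k-th entry of v_j, so [h k M] is the determinant of
   the columns times the product of these entries for j < 3. Its being nonzero says both that the
   columns are independent and that the rows can be normalized at [k]. *)
pose h k (M : quadruple K 3) :=
  \det (\matrix_(i < 3, j < 3) (M (widen_ord (leqnSn 3) j) - 1%:M) i k).
have hE k (M : quadruple K 3) u' v' : (forall j, M j = 1%:M + u' j *m v' j) ->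
    h k M = \det (cols3 u') * \prod_(i < 3) v' (widen_ord (leqnSn 3) i) 0 k.
  move=> ME; rewrite -(colsZ (fun j => v' j 0 k)); congr (\det _).
  by apply/matrixP => i j; rewrite mxE ME [1%:M + _]addrC addrK !mxE big_ord1 mulrC.
move=> Vz vu zE Uu; have par := variety_V_parallel x0 vu zE Vz.2 Uu.
have v_neq0 j : v j != 0 by have [] := rank1_neq0 (x1 j) (vu j).
have [k v3k] := rV0Pn _ (v_neq0 (inord 3)).
have hz : h k z != 0.
  rewrite (hE _ _ _ _ zE) mulf_neq0//; first by rewrite -unitfE -unitmxE.
  apply/prodf_neq0 => i _; have /sub_rVP[c vE] := par (widen_ord (leqnSn 3) i).
  rewrite vE mxE mulf_neq0//; apply: contraNneq (v_neq0 (widen_ord (leqnSn 3) i)) => c0.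
  by rewrite vE c0 scale0r.
exists (h k); split=> //.
  apply: (algebra_det (@polyfun_algebra K _)) => i j; under eq_fun do rewrite mxE.
  apply: (mx_algebraB (@polyfun_algebra K _)); first exact: polyfun_quadruple.
  exact: (mx_algebra_cst (@polyfun_algebra K _)).
exists 'X_ord_max, (@span_chart k 8); split; [exact: mpolyXU_neq0|exact: span_chart_regular|].
move=> {hz v3k v_neq0 par Uu zE vu v u Vz z} M VM hM.
have [u [v [vu ME]]] := variety_V_frame VM.
move: hM; rewrite (hE _ _ _ _ ME) mulf_eq0 negb_or => /andP[Uu /prodf_neq0 vk].
have {}Uu : cols3 u \in unitmx by rewrite unitmxE unitfE.
have par := variety_V_parallel x0 vu ME VM.2 Uu.
have [c vE] := choice (fun j => elimT sub_rVP (par j)).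
have v3k : v (inord 3) 0 k != 0.
  have := vk ord0 isT; rewrite vE mxE; apply: contraNneq => ->.
  by rewrite mulr0.
(* The rows are multiples of v_3; moving the scalars to the columns leaves one common row with k-th
   entry 1 and changes none of the matrices. *)
pose v' := (v (inord 3) 0 k)^-1 *: v (inord 3).
pose u' j := (c j * v (inord 3) 0 k) *: u j.
have uvE j : u' j *m v' = u j *m v j.
  rewrite -scalemxAl -scalemxAr scalerA mulfK// [in RHS]vE.
  by rewrite -scalemxAr.
have v'k : v' 0 k = 1 by rewrite mxE mulVf.
have vu' j : v' *m u' j = (x j - 1)%:M.
  rewrite -vu [in RHS]vE -scalemxAr -!scalemxAl scalerA; congr (_ *: _).
  by rewrite mulfK.
pose y i := v' 0 (lift k i); pose s j i := u' j (lift k i) 0.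
have E j : u' j *m v' = dual_col k (x j) y (s j) *m unit_row k y.
  by have [vEE uEE] := unit_row_dualP v'k (vu' j); rewrite {1}vEE {1}uEE.
exists (fun l => [:: s (inord 0) ord0; s (inord 0) (lift ord0 ord0); s (inord 1) ord0;
    s (inord 1) (lift ord0 ord0); s (inord 2) ord0; s (inord 2) (lift ord0 ord0);
    y ord0; y (lift ord0 ord0); 0]`_l).
  by rewrite mevalXU.
have ext (f : 'I_2 -> K) (w : nat -> K) a : (a <= 6)%N -> (w (a + 0)%N = f ord0) ->
    (w (a + 1)%N = f (lift ord0 ord0)) -> (fun i : 'I_2 => w (inord (a + i) : 'I_9)) = f.
  move=> a6 w0 w1; apply/funext; apply: ord2_ind; rewrite inordK ?w0 ?w1//.
    by rewrite addn0 (leq_ltn_trans a6).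
  by rewrite addn1 ltnS (leq_ltn_trans a6).
have frame j : j \in [:: inord 0; inord 1; inord 2 : 'I_4] ->
  1%:M + dual_col k (x j) y (s j) *m unit_row k y = M j by rewrite -E uvE ME.
apply: rep_last_eq (span_quad_rep _ _ _) VM.2 _ _ _;
  rewrite quadE -[RHS]frame ?inE ?eqxx ?orbT//;
  congr (_ + dual_col _ _ _ _ *m unit_row _ _); apply: ext; by rewrite ?inordK.
Qed.

End SpanChart.

(** * Duality, and the centralizer of a quadruple with parallel rows *)

Section RankT.
Variable K : numFieldType.

Lemma covered_near_sub (E : vectType K) n (X Y : set E) z :
  X `<=` Y -> covered_near n Y z -> covered_near n X z.
Proof.
move=> XY [h [ph hz [g [phi [g0 rphi hphi]]]]]; exists h; split=> //.
by exists g, phi; split=> // y /XY; apply: hphi.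
Qed.

(** Transposition reverses products, and reversing the indices restores the relation. Rows and
    columns of the reflections are exchanged, which reduces the case of independent rows to that of
    independent columns. *)
Definition rev_tr (M : quadruple K 3) : quadruple K 3 := [ffun j => (M (rev_ord j))^T].

Lemma rev_tr_linear : linear rev_tr.
Proof. by move=> a M N; apply/ffunP => j; rewrite !ffunE linearP. Qed.
HB.instance Definition _ := GRing.isLinear.Build _ _ _ _ rev_tr rev_tr_linear.

Lemma rev_trK : involutive rev_tr.
Proof. by move=> M; apply/ffunP => j; rewrite !ffunE rev_ordK trmxK. Qed.

Lemma rev_inord : ((rev_ord (inord 0 : 'I_4) = inord 3) * (rev_ord (inord 1 : 'I_4) = inord 2) *
  (rev_ord (inord 2 : 'I_4) = inord 1) * (rev_ord (inord 3 : 'I_4) = inord 0))%type.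
Proof. by do ![split]; apply: val_inj; rewrite /= !inordK. Qed.

Lemma rev_tr_rep M : is_rep M -> is_rep (rev_tr M).
Proof.
by rewrite /is_rep !ffunE !rev_inord -!trmx_mul !mulmxA => ->; rewrite trmx1.
Qed.

Lemma reflection_class_tr (a : K) M : reflection_class a M -> reflection_class a M^T.
Proof.
move=> [P Pu ->]; exists (invmx P)^T; first by rewrite unitmx_tr unitmx_inv.
by rewrite !trmx_mul tr_diag_mx -trmx_inv invmxK mulmxA.
Qed.

Lemma rev_tr_V (x : 'I_4 -> K) M : variety_V (fun j => reflection_class (x j)) M ->
  variety_V (fun j => reflection_class (x (rev_ord j))) (rev_tr M).
Proof.
move=> [CM rM]; split; last exact: rev_tr_rep.
by move=> j; rewrite ffunE; apply: reflection_class_tr.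
Qed.

Variable x : 'I_4 -> K.
Hypotheses (x0 : forall j, x j != 0) (x1 : forall j, x j != 1).
Let C j := reflection_class (x j).

Lemma subset_T_covered z : subset_T C z -> covered_near 8 (subset_T C) z.
Proof.
move=> [Vz cz]; have [u [v [vu zE]]] := variety_V_frame Vz.
apply: (@covered_near_sub _ _ _ (variety_V C)) => [M []//|].
have [Uu|/cols3_eq0[r r0 ru]] := boolP (cols3 u \in unitmx).
  exact: variety_V_span_covered Vz vu zE Uu.
have {}ru := row_fixed_last x1 vu zE Vz.2 ru.
pose u' j := (v (rev_ord j))^T; pose v' j := (u (rev_ord j))^T.
have vu' j : v' j *m u' j = (x (rev_ord j) - 1)%:M.
  by rewrite -trmx_mul vu tr_scalar_mx.
have zE' j : rev_tr z j = 1%:M + u' j *m v' j.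
  by rewrite ffunE zE -trmx_mul linearD /= trmx1.
have Vz' := rev_tr_V Vz.
have [Uu'|/cols3_eq0[r' r'0 ru']] := boolP (cols3 u' \in unitmx).
  have cov := variety_V_span_covered (fun j => x0 (rev_ord j)) (fun j => x1 (rev_ord j))
    Vz' vu' zE' Uu'.
  apply: (@covered_near_pullback K _ _ 8 _ _ rev_tr rev_tr z rev_trK _ cov).
  exact: rev_tr_V.
have {}ru' := row_fixed_last (fun j => x1 (rev_ord j)) vu' zE' Vz'.2 ru'.
have vr' j : v j *m r'^T = 0.
  apply: trmx_inj; rewrite trmx_mul trmxK trmx0.
  by have := ru' (rev_ord j); rewrite /u' rev_ordK.
have /cz/is_scalar_mxP[c cE] j : comm_mx (r'^T *m r) (z j).
  rewrite /comm_mx zE mulmxDr mulmxDl mulmx1 mul1mx.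
  by rewrite mulmxA -(mulmxA _ r) ru mulmx0 mul0mx mulmxA -(mulmxA (u j)) vr' mulmx0 mul0mx.
have v0 : v (inord 0) != 0 by have [] := rank1_neq0 (x1 (inord 0)) (vu _).
(* The row v_0 kills the outer product of [r'^T] and [r], so the scalar is 0; but an outer product
   of nonzero vectors is nonzero. *)
have c0 : c = 0.
  have /eqP := congr1 (mulmx (v (inord 0))) cE.
  by rewrite mulmxA vr' mul0mx mul_mx_scalar eq_sym scaler_eq0 (negPf v0) orbF => /eqP.
have [[i ri] [j rj]] := (rV0Pn _ r0, rV0Pn _ r'0).
have /eqP := congr1 (fun N : 'M__ => N j i) cE; rewrite c0 !mxE big_ord1 mxE mul0rn mulf_eq0.
by rewrite (negPf ri) (negPf rj).
Qed.

Hypothesis prod_x : x (inord 0) * x (inord 1) * x (inord 2) * x (inord 3) = 1.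

(** The common row v is a left eigenvector of every matrix, the last being 1 + w v; [prod_x] gives v
    w = x_3 - 1. If A commutes with 1 + u_j v and v e = 1, then A u_j = (v A e) u_j. The scalar does
    not depend on j, and u_0, u_1, u_2 form a basis, so A is scalar. *)
Lemma span_quad_T y s :
  cols3 (fun j => dual_col 0 (x j) y (s j)) \in unitmx -> subset_T C (span_quad x 0 y s).
Proof.
set u := fun j => _; set v := unit_row 0 y => Uu.
have vu j : v *m u j = (x j - 1)%:M by exact: unit_row_dual.
have v00 : v 0 0 = 1 by exact: unit_row_lead.
have vlast : v *m span_quad x 0 y s (inord 3) = x (inord 3) *: v.
  rewrite quadE; have E j : v *m (1%:M - (x j)^-1 *: (u j *m v)) = (x j)^-1 *: v.
    rewrite mulmxBr mulmx1 -scalemxAr mulmxA vu mul_scalar_mx scalerA mulrBr mulVf//.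
    by rewrite mulr1 scalerBl scale1r subKr.
  rewrite !mulmxA E -scalemxAl E -scalemxAl -scalemxAl E !scalerA; congr (_ *: _).
  apply: (mulfI (mulf_neq0 (mulf_neq0 (x0 (inord 0)) (x0 (inord 1))) (x0 (inord 2)))).
  by rewrite prod_x; field; rewrite !x0.
have lastE : exists w : 'cV_3, span_quad x 0 y s (inord 3) = 1%:M + w *m v.
  have M1 (p r : 'cV[K]_3) : exists w : 'cV_3,
    (1%:M + p *m v) *m (1%:M + r *m v) = 1%:M + w *m v.
    exists (r + p + p *m (v *m r)); rewrite mulmxDl mul1mx mulmxDr mulmx1 !mulmxDl !mulmxA.
    by rewrite !addrA.
  have E j : 1%:M - (x j)^-1 *: (u j *m v) = 1%:M + (- (x j)^-1 *: u j) *m v.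
    by rewrite -scalemxAl scaleNr.
  rewrite quadE !E; have [w ->] := M1 (- (x (inord 2))^-1 *: u (inord 2)) (- (x (inord 1))^-1
    *: u (inord 1)).
  exact: M1.
split.
  split; last exact: span_quad_rep.
  apply: ord4_ind; [rewrite quadE; exact: (reflection_classI (x1 _) v00 (vu _)).. | ].
  have [w wE] := lastE; rewrite wE; apply: reflection_classI => //.
  have : v *m w *m v = (x (inord 3) - 1) *: v.
    by rewrite -mulmxA -[w *m v](addKr 1%:M) -wE mulmxDr mulmxN mulmx1 vlast addrC scalerBl
      scale1r.
  rewrite [v *m w]mx11_scalar mul_scalar_mx => /(congr1 (fun N : 'M__ => N 0 0)).
  by rewrite [LHS]mxE [RHS]mxE v00 !mulr1 => ->.
move=> A cA; pose e : 'cV[K]_3 := delta_mx 0 0.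
have ve : v *m e = 1%:M.
  by rewrite -colE [LHS]mx11_scalar mxE v00.
have Au j : j \in [:: inord 0; inord 1; inord 2 : 'I_4] -> A *m u j = (v *m A *m e) 0 0 *: u j.
  move=> jlt; have E : span_quad x 0 y s j = 1%:M + u j *m v.
    by move: jlt; rewrite !inE => /or3P[] /eqP->; rewrite quadE.
  have := cA j; rewrite /comm_mx E mulmxDr mulmxDl mulmx1 mul1mx => /addrI.
  move/(congr1 (fun N => N *m e)); rewrite -!mulmxA ve mulmx1 => ->.
  by rewrite {1}[v *m _]mx11_scalar mul_mx_scalar.
apply/is_scalar_mxP; exists ((v *m A *m e) 0 0).
apply: (can_inj (mulmxK Uu)); rewrite mul_scalar_mx; apply/matrixP => i j.
have jE : widen_ord (leqnSn 3) j \in [:: inord 0; inord 1; inord 2 : 'I_4].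
  by rewrite !inord_widen; elim/ord3_ind: j; rewrite !inE eqxx ?orbT.
have /colP/(_ i) := Au _ jE; rewrite !mxE => <-.
by apply: eq_bigr => l _; rewrite mxE.
Qed.

End RankT.

(** * A chart of quadruples with trivial centralizer *)

Section DimensionT.
Variables (K : numFieldType) (x : 'I_4 -> K).
Hypotheses (x0 : forall j, x j != 0) (x1 : forall j, x j != 1).
Hypothesis prod_x : x (inord 0) * x (inord 1) * x (inord 2) * x (inord 3) = 1.
Let C j := reflection_class (x j).

Lemma span_quad_first k y s (j : nat) : (j < 3)%N ->
  span_quad x k y s (inord j) = 1%:M + dual_col k (x (inord j)) y (s (inord j)) *m unit_row k y.
Proof. by case: j => [|[|[|]]]// _; rewrite quadE. Qed.

(** The row is (1, 0, 0) and the columns are (x_0 - 1, 0, 0), (x_1 - 1, 1, 0) and (x_2 - 1, 0, 1), a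
    triangular frame. *)
Let w0 (l : 'I_8) : K := [:: 0; 0; 1; 0; 0; 1; 0; 0]`_l.

Let frame (w : 'I_8 -> K) : 'M[K]_3 :=
  cols3 (fun j => dual_col 0 (x j) (fun i : 'I_2 => w (inord (6 + i)))
    (fun i : 'I_2 => w (inord (2 * j + i)))).

Lemma base_frame_unit : frame w0 \in unitmx.
Proof.
pose Q : 'M[K]_3 := \matrix_(i, j) if i == 0 then
    if j == 0 then (x (inord 0) - 1)^-1 else
    if j == lift ord0 ord0 then - (x (inord 1) - 1) / (x (inord 0) - 1)
    else - (x (inord 2) - 1) / (x (inord 0) - 1)
  else (i == j)%:R.
have x10 : x (inord 0) - 1 != 0 by rewrite subr_eq0.
have d0 a y s : dual_col 0 a y s (ord0 : 'I_3) 0 = a - 1 - \sum_i y i * s i.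
  by rewrite mxE unlift_none.
have dS a y s (i : 'I_2) : dual_col 0 a y s (lift ord0 i : 'I_3) 0 = s i.
  by rewrite mxE liftK.
suff /mulmx1_unit[] : frame w0 *m Q = 1%:M by [].
apply/matrixP => i j; rewrite mxE !big_ord_recl big_ord0 /frame !cols3E.
have y0 a s : a - 1 - \sum_(i < 2) w0 (inord (6 + i)) * s i = a - 1.
  by rewrite !big_ord_recl big_ord0 /w0 !inordK// !mul0r !addr0 subr0.
elim/ord3_ind: i; elim/ord3_ind: j; rewrite ?d0 ?dS ?y0 !mxE /= /w0 ?inordK //=; by field.
Qed.

Lemma subset_T_chain : exists Z, irreducible_chain (subset_T C) 8 Z.
Proof.
have alg := regular_algebra (1 : {mpoly K[8]}).
have [q qE] : exists q : {mpoly K[8]}, forall w, \det (frame w) = q.@[w].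
  apply: regular1P; apply: (algebra_det alg) => i j; under eq_fun do rewrite mxE.
  by apply: dual_col_algebra => // l; apply: regular_coord.
have qP w : q.@[w] != 0 -> frame w \in unitmx by rewrite unitmxE unitfE qE.
apply: (@chain_of_chart K _ 8 _ q (@span_chart K x 0 7) w0).
- exact: span_chart_regular.
- by move=> w /qP; apply: span_quad_T.
- by rewrite -qE -unitfE -unitmxE base_frame_unit.
move=> i; pose e (k : 'I_8) : K := w0 k + (k == i)%:R.
have Le : coord_flat w0 i.+1 e.
  by move=> k ik; rewrite /e eqE /= gtn_eqF ?addr0.
have regE j a b : regular 1 (fun w => @span_chart K x 0 7 w j a b).
  exact: (@span_chart_regular K x 0 7 1 _ (@polyfun_quadruple K 3 j a b)).
(* A coordinate of a column is itself an entry of the first column of the matrix of index [i./2]. A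
   coordinate of the row only appears multiplied by x_0 - 1 - sum y s, which is x_0 - 1 at [e]
   because the free entries of u_0 are 0 there. *)
have [i6|i6] := ltnP i 6.
  have j3 : (i./2 < 3)%N by rewrite -ltn_double; case: (i : nat) i6 => [|[|[|[|[|[|]]]]]].
  pose r : 'I_2 := inord (odd i).
  have rE : r = odd i :> nat by rewrite inordK// ltnS leq_b1.
  have FE w : @span_chart K x 0 7 w (inord i./2) (lift 0 r) 0 = w i.
    rewrite /span_chart span_quad_first// chart_entry_col rE inordK ?(ltn_trans j3)//.
    by rewrite mul2n addnC odd_double_half inord_val.
  exists (fun M : quadruple K 3 => M (inord i./2) (lift 0 r) 0 - w0 i), (fun w => w i - w0 i).
  split=> [||w Lw _|w _|].
  - apply: (algebraB (@polyfun_algebra K _)); first exact: polyfun_quadruple.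
    exact: (algebra_cst (@polyfun_algebra K _)).
  - by apply: (algebraB alg); [apply: regular_coord|apply: (algebra_cst alg)].
  - by rewrite FE Lw// subrr.
  - by rewrite FE.
  - by exists e; rewrite // /e eqxx addrAC subrr add0r oner_neq0.
have r2 : (i - 6 < 2)%N by rewrite ltn_subLR.
have w0i : w0 i = 0 by rewrite /w0; case: (i : nat) i6 r2 => [|[|[|[|[|[|[|[|]]]]]]]].
have FE w : @span_chart K x 0 7 w (inord 0) 0 (lift 0 (Ordinal r2)) =
    (x (inord 0) - 1 - \sum_(l < 2) w (inord (6 + l)) * w (inord l)) * w i.
  rewrite /span_chart span_quad_first// chart_entry_row /= inordK// subnKC// inord_val.
  by congr ((_ - _) * _); apply: eq_bigr => l _; rewrite muln0 add0n.
exists (fun M : quadruple K 3 => M (inord 0) 0 (lift 0 (Ordinal r2))),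
  (fun w => @span_chart K x 0 7 w (inord 0) 0 (lift 0 (Ordinal r2))).
split=> // [|w Lw _|]; first exact: polyfun_quadruple.
  by rewrite FE Lw// w0i mulr0.
exists e => //; rewrite FE /e eqxx.
rewrite w0i add0r mulr1 big1 ?subr0 ?subr_eq0// => l _.
have -> : w0 (inord l) + (inord l == i)%:R = 0.
  rewrite eqE /= /w0 inordK; last by apply: leq_trans (ltn_ord l) _.
  rewrite ltn_eqF ?addr0; last by apply: leq_trans (ltn_ord l) _; apply: leq_trans i6.
  by case: l => [[|[|]]].
by rewrite mulr0.
Qed.

Lemma has_dim_subset_T : has_dim (subset_T C) 8.
Proof.
split; first exact: subset_T_chain.
by move=> m Z; apply: covered_dim_le => z; apply: subset_T_covered.
Qed.

End DimensionT.

(** * Direct sums *)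

Section CommonEigenvector.
Variable K : fieldType.

Lemma irreducible_no_eigenvector (A : quadruple K 2) (w : 'cV[K]_2) : irreducible_rep A ->
  w != 0 -> ~ (forall j, exists c, A j *m w = c *: w).
Proof.
move=> [_ _ irrA] w0 Aw.
have dimw : \dim <[w]> = 1%N by rewrite dim_vline w0.
have [||Uw] := irrA <[w]>%VS.
- move=> j v /vlineP[a ->]; have [c E] := Aw j.
  by rewrite -scalemxAr E; apply/vlineP; exists (a * c); rewrite scalerA.
- by move=> Uw; move: dimw; rewrite Uw dimv0.
- by move: dimw; rewrite Uw dimvf /dim /= muln1.
Qed.

(** The relation may be rotated cyclically, so each matrix is inverse to the product of the other
    three. *)
Lemma rep_eigenvector_last n (A : quadruple K n) (w : 'cV[K]_n) l : is_rep A -> w != 0 ->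
  (forall j, j != l -> exists c, A j *m w = c *: w) -> exists c, A l *m w = c *: w.
Proof.
move=> rA w0 Aw.
have key (B D : 'M[K]_n) c : B *m D = 1%:M -> D *m w = c *: w -> exists c', B *m w = c' *: w.
  move=> BD Dw; exists c^-1; have := congr1 (fun N => N *m w) BD.
  rewrite -mulmxA Dw -scalemxAr mul1mx => E.
  have c0 : c != 0 by apply: contraNneq w0 => c0; rewrite -E c0 scale0r.
  by rewrite -E scalerA mulVf// scale1r E.
have comb (B D E : 'M[K]_n) : (exists c, B *m w = c *: w) -> (exists c, D *m w = c *: w) ->
    (exists c, E *m w = c *: w) -> exists c, B *m D *m E *m w = c *: w.
  move=> [b Bw] [d Dw] [e Ew]; exists (e * d * b).
  by rewrite -!mulmxA Ew -!scalemxAr Dw -!scalemxAr Bw !scalerA.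
have neq a b := @inord_neq 3 a b.
rewrite /is_rep in rA.
elim/ord4_ind: l Aw => Aw.
- have [c] := comb _ _ _ (Aw (inord 1) (neq 1 0 isT isT isT)%N) (Aw (inord 2) (neq 2 0 isT isT
  isT)%N) (Aw (inord 3) (neq 3 0 isT isT isT)%N).
  by apply: key; rewrite !mulmxA.
- have [c] := comb _ _ _ (Aw (inord 2) (neq 2 1 isT isT isT)%N) (Aw (inord 3) (neq 3 1 isT isT
  isT)%N) (Aw (inord 0) (neq 0 1 isT isT isT)%N).
  apply: key; move: rA; rewrite -!mulmxA => /mulmx1C; by rewrite !mulmxA.
- have [c] := comb _ _ _ (Aw (inord 3) (neq 3 2 isT isT isT)%N) (Aw (inord 0) (neq 0 2 isT isT
  isT)%N) (Aw (inord 1) (neq 1 2 isT isT isT)%N).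
  apply: key; move: rA; rewrite -(mulmxA _ (A (inord 2))) => /mulmx1C; by rewrite !mulmxA.
- have [c] := comb _ _ _ (Aw (inord 0) (neq 0 3 isT isT isT)%N) (Aw (inord 1) (neq 1 3 isT isT
  isT)%N) (Aw (inord 2) (neq 2 3 isT isT isT)%N).
  by apply: key; apply: mulmx1C.
Qed.

Lemma ord4_complement (i j : 'I_4) : i != j ->
  exists k l : 'I_4, forall m, m \in [:: i; j; k; l].
Proof.
move=> ij; pose s := enum (predC (pred2 i j)).
have : size s = 2%N.
  by rewrite -cardE; have := cardC (pred2 i j); rewrite card2 ij card_ord => -[].
have memE m : m \in s = (m \notin pred2 i j) by rewrite mem_enum.
case: s memE => [|k [|l []]]// memE _; exists k, l => m.
by have := memE m; rewrite !inE; case: (m == i); case: (m == j) => //= ->.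
Qed.

(** The column of a third matrix, or any nonzero vector if that column is 0, is an eigenvector of
    three of the matrices and hence of the fourth. *)
Lemma irreducible_trivial_factors (A : quadruple K 2) i j : irreducible_rep A ->
  (forall j, exists (u : 'cV_2) (v : 'rV_2), A j = 1%:M + u *m v) ->
  i != j -> A i = 1%:M -> A j = 1%:M -> False.
Proof.
move=> irrA Auv /ord4_complement[k [l klP]] Ai Aj.
have [w w0 [c wk]] : exists2 w : 'cV[K]_2, w != 0 & exists c, A k *m w = c *: w.
  have [u [v ->]] := Auv k.
  have [u0|u0] := eqVneq u 0.
    exists (const_mx 1); last by exists 1; rewrite u0 mul0mx addr0 mul1mx scale1r.
    by apply/eqP => /colP/(_ 0); rewrite !mxE; apply/eqP/oner_neq0.
  exists u => //; exists (1 + (v *m u) 0 0).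
  by rewrite mulmxDl mul1mx -mulmxA {1}[v *m u]mx11_scalar mul_mx_scalar scalerDl scale1r.
have Aw m : m != l -> exists c, A m *m w = c *: w.
  have := klP m; rewrite !inE => /or4P[] /eqP->; rewrite ?eqxx// => _; last by exists c.
    by exists 1; rewrite Ai mul1mx scale1r.
  by exists 1; rewrite Aj mul1mx scale1r.
apply: (irreducible_no_eigenvector irrA w0) => m.
have [->|/Aw//] := eqVneq m l.
by case: irrA => rA _ _; apply: rep_eigenvector_last rA w0 Aw.
Qed.

(** Two diagonal blocks cannot share rank one: if b is nonzero, so is the last entry of [v], and the
    zero block in the upper right corner makes the upper part of [u] vanish. *)
Lemma block_rank1 (X : 'M[K]_2) (b : 'M[K]_1) (u : 'cV[K]_(2 + 1)) (v : 'rV[K]_(2 + 1)) :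
  block_mx X 0 0 b = u *m v -> (b = 0 \/ X = 0) /\ X = usubmx u *m lsubmx v.
Proof.
rewrite -[u]vsubmxK -[v]hsubmxK mul_col_row => /eq_block_mx[XE ur _ bE].
rewrite !col_mxKu !row_mxKl in XE *; split=> //.
have [->|b0] := eqVneq b 0; [by left|right].
rewrite XE; suff -> : usubmx u = 0 by rewrite mul0mx.
have v0 : rsubmx v 0 0 != 0.
  apply: contraNneq b0 => v0; rewrite bE [rsubmx v]mx11_scalar v0.
  by rewrite raddf0 mulmx0.
move: ur; rewrite [rsubmx v]mx11_scalar mul_mx_scalar => /esym/eqP.
by rewrite scaler_eq0 (negPf v0) => /eqP.
Qed.

End CommonEigenvector.

(** * The one-dimensional summand is trivial *)

Section StructureS.
Variables (K : fieldType) (x : 'I_4 -> K).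
Let C j := reflection_class (x j).

Lemma subset_S_structure (M : quadruple K 3) : subset_S C M ->
  exists (R : 'M[K]_(2 + 1)) (A : quadruple K 2) (u : 'I_4 -> 'cV[K]_2) (v : 'I_4 -> 'rV[K]_2),
   [/\ R \in unitmx, irreducible_rep A,
      forall j, v j *m u j = (x j - 1)%:M, forall j, A j = 1%:M + u j *m v j &
      forall j, M j = R *m block_mx (A j) 0 0 1%:M *m invmx R].
Proof.
move=> [[CM rM] [A [B [irrA rB [R Ru ME]]]]].
have [u' u'P] := choice (fun j => reflection_classW (CM j)).
have [v' v'P] := choice u'P.
pose U j : 'cV[K]_(2 + 1) := invmx R *m u' j.
pose V j : 'rV[K]_(2 + 1) := v' j *m R.
have VU j : V j *m U j = (x j - 1)%:M by rewrite mulmxA mulmxK// (v'P j).1.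
have E j : block_mx (A j - 1%:M) 0 0 (B j - 1%:M) = U j *m V j.
  have -> : block_mx (A j - 1%:M) 0 0 (B j - 1%:M) = block_mx (A j) 0 0 (B j) - 1%:M.
    by rewrite [in RHS]scalar_mx_block opp_block_mx add_block_mx !oppr0 !addr0.
  have -> : U j *m V j = invmx R *m (M j - 1%:M) *m R.
    by rewrite (v'P j).2 [1%:M + _]addrC addrK !mulmxA.
  rewrite ME /direct_sum ffunE mulmxBr mulmxBl mulmx1 mulVmx// !mulmxA mulVmx// mul1mx.
  by rewrite mulmxKV.
have AE j : A j = 1%:M + usubmx (U j) *m lsubmx (V j).
  by have [_ <-] := block_rank1 (E j); rewrite addrC subrK.
(* At each index A or B is the identity. Irreducibility forbids A to be the identity at two indices,
   so B differs from it at one index at most, and there the relation for B makes it 1 as well. *)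
have B1 j : B j = 1%:M.
  have dich i : B i = 1%:M \/ A i = 1%:M.
    by have [[H|H] _] := block_rank1 (E i); [left|right]; apply/eqP; rewrite -subr_eq0 H.
  have [//|Aj] := dich j.
  have Bi i : i != j -> B i = 1%:M.
    move=> ij; have [//|Ai] := dich i.
    case: (@irreducible_trivial_factors K A i j irrA _ ij Ai Aj) => i'.
    by exists (usubmx (U i')), (lsubmx (V i')).
  rewrite /is_rep in rB; move: Bi; elim/ord4_ind: j {Aj} => Bi.
  - by move: rB; rewrite !(Bi (inord 1), Bi (inord 2), Bi (inord 3)) ?inord_neq// !mulmx1.
  - by move: rB; rewrite !(Bi (inord 0), Bi (inord 2),
    Bi (inord 3)) ?inord_neq// !mulmx1 mul1mx.
  - by move: rB; rewrite !(Bi (inord 0), Bi (inord 1),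
    Bi (inord 3)) ?inord_neq// !mulmx1 !mul1mx.
  - by move: rB; rewrite !(Bi (inord 0), Bi (inord 1), Bi (inord 2)) ?inord_neq// !mul1mx.
exists R, A, (fun j => usubmx (U j)), (fun j => lsubmx (V j)); split=> // [j|j].
  rewrite [LHS]mx11_scalar; congr _%:M; rewrite -[LHS]mulr1n -mxtrace_scalar -mx11_scalar.
  rewrite mxtrace_mulC; have [_ <-] := block_rank1 (E j).
  have := congr1 mxtrace (E j); rewrite mxtrace_block B1 subrr raddf0 addr0 => ->.
  by rewrite mxtrace_mulC VU mxtrace_scalar mulr1n.
by rewrite ME /direct_sum ffunE B1.
Qed.

End StructureS.

(** * Quadruples built from a plane representation and a splitting *)

Section PlaneChart.
Variables (K : numFieldType) (x : 'I_4 -> K).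
Hypotheses (x0 : forall j, x j != 0) (x1 : forall j, x j != 1).
Let C j := reflection_class (x j).

(** When Q P = 1, the lifted matrices act as A on the image of [P] and as the identity on the kernel
    of [Q]: these are the two summands. *)
Definition lift_quad (P : 'M[K]_(2 + 1, 2)) (Q : 'M[K]_(2, 2 + 1)) (A : quadruple K 2) :
    quadruple K 3 :=
  [ffun j => 1%:M + P *m (A j - 1%:M) *m Q].

Lemma lift_mulmx (P : 'M[K]_(2 + 1, 2)) Q (X Y : 'M[K]_2) : Q *m P = 1%:M ->
  (1%:M + P *m (X - 1%:M) *m Q) *m (1%:M + P *m (Y - 1%:M) *m Q) =
  1%:M + P *m (X *m Y - 1%:M) *m Q.
Proof.
move=> QP; rewrite mulmxDl mul1mx mulmxDr mulmx1 -addrA; congr (_ + _).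
rewrite !mulmxA -(mulmxA _ Q P) QP mulmx1 -!mulmxDl; congr (_ *m _).
rewrite -(mulmxA P) -!mulmxDr; congr (_ *m _).
rewrite mulmxBl mul1mx; set y := Y - 1%:M.
by rewrite addrC -!addrA addNr addr0 mulmxBr mulmx1 addrC -addrA subrK addrC.
Qed.

Lemma lift_quad_rep P Q A : Q *m P = 1%:M -> is_rep A -> is_rep (lift_quad P Q A).
Proof.
move=> QP rA; rewrite /is_rep !ffunE !lift_mulmx// rA.
by rewrite subrr mulmx0 mul0mx addr0.
Qed.

Definition plane_quad (t s : 'I_4 -> K) : quadruple K 2 :=
  let X j := dual_col (0 : 'I_2) (x j) (fun=> t j) (fun=> s j) *m unit_row (0 : 'I_2) (fun=> t
    j) in
  let V j := 1%:M - (x j)^-1 *: X j in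
  quad (1%:M + X (inord 0)) (1%:M + X (inord 1)) (1%:M + X (inord 2))
    (V (inord 2) *m V (inord 1) *m V (inord 0)).

Lemma plane_quad_rep t s : is_rep (plane_quad t s).
Proof.
rewrite /is_rep !quadE !mulmxA.
have E j := reflection_mulV (x0 j) (unit_row_dual (0 : 'I_2) (x j) (fun=> t j) (fun=> s j)).
by rewrite -(mulmxA _ _ (_ - (x (inord 2))^-1 *: _)) E mulmx1
  -(mulmxA _ _ (_ - (x (inord 1))^-1 *: _)) E mulmx1 E.
Qed.

(** A change of basis of the plane normalizes Q to (1 q) when its left block is invertible; Q P = 1
    then determines the upper block of P from q and p. *)
Definition S_quad (t s : 'I_4 -> K) (q : 'cV[K]_2) (p : 'rV[K]_2) : quadruple K 3 :=
  lift_quad (col_mx (1%:M - q *m p) p) (row_mx 1%:M q) (plane_quad t s).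

Lemma splitting_dual (q : 'cV[K]_2) (p : 'rV[K]_2) :
  row_mx 1%:M q *m col_mx (1%:M - q *m p) p = 1%:M.
Proof. by rewrite mul_row_col mul1mx subrK. Qed.

Lemma S_quad_rep t s q p : is_rep (S_quad t s q p).
Proof. exact: lift_quad_rep (splitting_dual q p) (plane_quad_rep t s). Qed.

Lemma mx_algebra_col T (A : set (T -> K)) m1 m2 n (F : T -> 'M[K]_(m1, n)) (G : T ->
  'M[K]_(m2, n)) :
  mx_algebra A F -> mx_algebra A G -> mx_algebra A (fun w => col_mx (F w) (G w)).
Proof.
move=> aF aG i j; case: (split_ordP i) => a ->.
  by under eq_fun do rewrite col_mxEu; apply: aF.
by under eq_fun do rewrite col_mxEd; apply: aG.
Qed.

Lemma mx_algebra_row T (A : set (T -> K)) m n1 n2 (F : T -> 'M[K]_(m, n1)) (G : T ->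
  'M[K]_(m, n2)) :
  mx_algebra A F -> mx_algebra A G -> mx_algebra A (fun w => row_mx (F w) (G w)).
Proof.
move=> aF aG i j; case: (split_ordP j) => a ->.
  by under eq_fun do rewrite row_mxEl; apply: aF.
by under eq_fun do rewrite row_mxEr; apply: aG.
Qed.

Lemma plane_quad_algebra T (A : set (T -> K)) (t s : 'I_4 -> T -> K) j :
  fun_algebra A -> (forall j, A (t j)) -> (forall j, A (s j)) ->
  mx_algebra A (fun w => plane_quad (fun j => t j w) (fun j => s j w) j).
Proof.
move=> alg At As; have one : mx_algebra A (fun=> 1%:M : 'M[K]_2) by exact: (mx_algebra_cst alg).
have X i : mx_algebra A (fun w => dual_col (0 : 'I_2) (x i) (fun=> t i w) (fun=> s i w)
    *m unit_row (0 : 'I_2) (fun=> t i w)).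
  apply: (mx_algebraM alg).
    by apply: (@dual_col_algebra K T A 1 0 (x i) (fun=> t i) (fun=> s i)).
  by apply: (@unit_row_algebra K T A 1 0 (fun=> t i)).
have V i : mx_algebra A (fun w => 1%:M - (x i)^-1 *: (dual_col (0 : 'I_2) (x i) (fun=> t i w)
  (fun=> s i w)
    *m unit_row (0 : 'I_2) (fun=> t i w))).
  apply: (mx_algebraB alg) => //; apply: (mx_algebraZ alg) => //.
  exact: (algebra_cst alg).
elim/ord4_ind: j; under eq_fun do rewrite /plane_quad quadE.
- exact: (mx_algebraD alg).
- exact: (mx_algebraD alg).
- exact: (mx_algebraD alg).
- by do 2![apply: (mx_algebraM alg) => //].
Qed.

Lemma S_quad_algebra T (A : set (T -> K)) (t s : 'I_4 -> T -> K) (q p : 'I_2 -> T -> K) j :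
  fun_algebra A -> (forall j, A (t j)) -> (forall j, A (s j)) ->
  (forall i, A (q i)) -> (forall i, A (p i)) ->
  mx_algebra A (fun w => S_quad (fun j => t j w) (fun j => s j w)
    (\col_i q i w) (\row_i p i w) j).
Proof.
move=> alg At As Aq Ap; under eq_fun do rewrite /S_quad ffunE.
have cst m n (N : 'M[K]_(m, n)) : mx_algebra A (fun=> N) by exact: (mx_algebra_cst alg).
have Aqm : mx_algebra A (fun w => \col_i q i w).
  by move=> i l; under eq_fun do rewrite mxE; apply: Aq.
have Apm : mx_algebra A (fun w => \row_i p i w).
  by move=> i l; under eq_fun do rewrite mxE; apply: Ap.
apply: (mx_algebraD alg) => //; apply: (mx_algebraM alg).
  apply: (mx_algebraM alg).
    apply: (@mx_algebra_col T A 2 1 2) => //; apply: (mx_algebraB alg) => //.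
    exact: (mx_algebraM alg).
  by apply: (mx_algebraB alg) => //; apply: plane_quad_algebra.
exact: (@mx_algebra_row T A 2 2 1 _ _ (cst _ _ _) Aqm).
Qed.

Lemma subset_S_form (M : quadruple K 3) : subset_S C M ->
  exists (P : 'M[K]_(2 + 1, 2)) (Q : 'M[K]_(2, 2 + 1)) (u : 'I_4 -> 'cV[K]_2) (v : 'I_4 ->
    'rV[K]_2),
   [/\ Q *m P = 1%:M, forall j, v j *m u j = (x j - 1)%:M,
      is_rep [ffun j => 1%:M + u j *m v j] &
      forall j, M j = 1%:M + P *m (u j *m v j) *m Q].
Proof.
move=> /subset_S_structure[R [A [u [v [Ru [rA _ _] vu AE ME]]]]].
exists (R *m col_mx 1%:M 0), (row_mx 1%:M 0 *m invmx R), u, v; split=> //.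
- by rewrite mulmxA mulmxKV// mul_row_col mulmx1 mul0mx addr0.
- by rewrite (_ : [ffun j => _] = A)//; apply/ffunP => j; rewrite ffunE AE.
move=> j; have RE : 1%:M = R *m 1%:M *m invmx R by rewrite mulmx1 mulmxV.
rewrite ME AE !mulmxA [X in _ = X + _]RE -mulmxDl; congr (_ *m _).
rewrite -!mulmxA -mulmxDr; congr (_ *m _).
rewrite [X in _ = X + _]scalar_mx_block !mulmxA mul_col_mx mul1mx mul0mx.
rewrite mul_col_mx mul0mx mul_col_row !mulmx1 !mulmx0 add_block_mx.
by rewrite !addr0.
Qed.

Lemma refl_chart2 a (u : 'cV[K]_2) (v : 'rV[K]_2) : v *m u = (a - 1)%:M -> v 0 0 != 0 ->
  exists t s, u *m v = dual_col (0 : 'I_2) a (fun=> t) (fun=> s) *m unit_row (0 : 'I_2) (fun=>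
    t).
Proof.
move=> vu v0; have [|u' [v' [v'0 + <-]]] := @rank1_normalize K 2 2 0 (a - 1) u 1%:M v v0;
  rewrite !mul1mx// => v'u'.
have [vE uE] := unit_row_dualP v'0 v'u'.
exists (v' 0 (lift 0 0)), (u' (lift 0 0) 0); rewrite {1}vE {1}uE.
by congr (dual_col _ _ _ _ *m unit_row _ _); apply/funext => i; rewrite (ord1 i).
Qed.

End PlaneChart.

Lemma mulmx2E (K : comNzRingType) m n (X : 'M[K]_(m, 2)) (Y : 'M[K]_(2, n)) i j :
  (X *m Y) i j = X i ord0 * Y ord0 j + X i (lift ord0 ord0) * Y (lift ord0 ord0) j.
Proof. by rewrite mxE !big_ord_recl big_ord0 addr0. Qed.

Lemma mxtrace2 (K : comNzRingType) (X : 'M[K]_2) :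
  \tr X = X ord0 ord0 + X (lift ord0 ord0) (lift ord0 ord0).
Proof. by rewrite /mxtrace !big_ord_recl big_ord0 addr0. Qed.

(** * The trace equation, and covering of quadruples in general position *)

Section CoverS.
Variables (K : numFieldType) (x : 'I_4 -> K).
Hypotheses (x0 : forall j, x j != 0) (x1 : forall j, x j != 1).
Hypothesis prod_x : x (inord 0) * x (inord 1) * x (inord 2) * x (inord 3) = 1.
Let C j := reflection_class (x j).

Definition S_chart n (w : 'I_n.+1 -> K) : quadruple K 3 :=
  S_quad x (fun j => w (inord (2 * j))) (fun j => w (inord (2 * j).+1))
    (\col_i w (inord (6 + i))) (\row_i w (inord (8 + i))).

Lemma S_chart_regular n (q : {mpoly K[n.+1]}) : regular_map q (@S_chart n).
Proof.
apply: regular_map_quadruple => j.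
apply: (@S_quad_algebra K x _ _ (fun j w => w (inord (2 * j))) (fun j w => w (inord (2 * j).+1))
  (fun i w => w (inord (6 + i))) (fun i w => w (inord (8 + i))));
  do ?[by move=> i; apply: regular_coord]; exact: regular_algebra.
Qed.

(** The inverse of a reflection of ratio x_3 in the plane has eigenvalues 1 and 1/x_3. The
    determinant of the product is already right when the x_j have product 1; this is the remaining
    condition on its characteristic polynomial. *)
Definition trace_defect (t s : 'I_4 -> K) : K :=
  \tr (plane_quad x t s (inord 0) *m plane_quad x t s (inord 1) *m plane_quad x t s (inord 2))
  - (1 + (x (inord 3))^-1).

Lemma plane_quad_first t s (j : nat) : (j < 3)%N ->
  plane_quad x t s (inord j) = 1%:M + dual_col (0 : 'I_2) (x (inord j)) (fun=> t (inord j))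
    (fun=> s (inord j)) *m unit_row (0 : 'I_2) (fun=> t (inord j)).
Proof. by case: j => [|[|[|]]]// _; rewrite quadE. Qed.

Lemma plane_matrixE (a t s : K) (i j : 'I_2) :
  (1%:M + dual_col (0 : 'I_2) a (fun=> t) (fun=> s) *m unit_row (0 : 'I_2) (fun=> t)) i j =
  if i == 0 then (if j == 0 then a - t * s else (a - 1 - t * s) * t)
  else (if j == 0 then s else 1 + s * t).
Proof.
elim/ord2_ind: i; elim/ord2_ind: j;
  rewrite !mxE big_ord1 !mxE ?unlift_none ?liftK /= ?big_ord1 ?add0r ?mulr1 //=; ring.
Qed.

Lemma rep_trace (A : quadruple K 2) (u : 'cV[K]_2) (v : 'rV[K]_2) : is_rep A ->
  v *m u = (x (inord 3) - 1)%:M -> A (inord 3) = 1%:M + u *m v ->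
  \tr (A (inord 0) *m A (inord 1) *m A (inord 2)) = 1 + (x (inord 3))^-1.
Proof.
move=> rA vu AE; rewrite (rep_last (x0 _) vu AE rA) linearB linearZ /= mxtrace1.
by rewrite mxtrace_mulC vu mxtrace_scalar; field; rewrite x0.
Qed.

Lemma trace_defect_regular n : exists g : {mpoly K[n.+1]}, forall w,
  trace_defect (fun j => w (inord (2 * j))) (fun j => w (inord (2 * j).+1)) = g.@[w].
Proof.
have alg := regular_algebra (1 : {mpoly K[n.+1]}).
apply: regular1P; apply: (algebraB alg); last exact: (algebra_cst alg).
have P j := @plane_quad_algebra K x _ (regular (1 : {mpoly K[n.+1]}))
  (fun j w => w (inord (2 * j))) (fun j w => w (inord (2 * j).+1)) j alg
  (fun j => regular_coord _ _) (fun j => regular_coord _ _).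
by apply: (algebra_trace alg); do 2![apply: (mx_algebraM alg) => //].
Qed.

Lemma trace_defect_neq0 : exists w : 'I_10 -> K,
  trace_defect (fun j => w (inord (2 * j))) (fun j => w (inord (2 * j).+1)) != 0.
Proof.
(* The order is t_0, s_0, t_1, s_1, t_2, s_2: A_0 is lower triangular, A_1 diagonal, A_2 upper
   triangular, and the defect is x_1 (x_2 - 1). *)
exists (fun l : 'I_10 => ([:: 0; 1; 0; 0; 1; 0] : seq K)`_l).
rewrite /trace_defect !plane_quad_first// mxtrace2 !mulmx2E !plane_matrixE /= !inordK //=.
set b := x (inord 1).
have -> : (x (inord 3))^-1 = x (inord 0) * b * x (inord 2).
  by apply: (mulIf (x0 (inord 3))); rewrite mulVf// prod_x.
have : b * (x (inord 2) - 1) != 0 by rewrite mulf_neq0 ?x0// subr_eq0.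
by congr (_ != 0); ring.
Qed.

Lemma subset_S_covered_split (z : quadruple K 3) (u : 'I_4 -> 'cV[K]_2) (v : 'I_4 ->
  'rV[K]_2) i1 i2 :
  (forall j, v j *m u j = (x j - 1)%:M) ->
  (forall j, z j = block_mx (1%:M + u j *m v j) 0 0 1%:M :> 'M_(2 + 1)) ->
  (forall j : 'I_3, v (widen_ord (leqnSn 3) j) 0 0 != 0) ->
  \det (\matrix_(a, b) v (if a == 0 then i1 else i2) 0 b : 'M_2) != 0 ->
  covered_near 9 (subset_S C) z.
Proof.
move=> vu zE v0 dv.
have /choice[k uk] : forall j, exists k : 'I_2, u j k 0 != 0.
  by move=> j; have [/cV0Pn] := rank1_neq0 (x1 j) (vu j).
pose ii (a : 'I_2) := if a == 0 then i1 else i2.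
pose kk j : 'I_3 := @lshift 2 1 (k j).
(* The determinant of [hd] uses the independent rows v_i1 and v_i2 to make the determinant of the
   left block of Q a factor of a polynomial in the entries of M. The product in [h] adds the first
   entries of the rows v_j Q for j < 3. All of these must be nonzero for the normalization below. *)
pose hd (M : quadruple K 3) := \matrix_(a < 2, b < 2)
  (M (ii a) - 1%:M) (kk (ii a)) (@lshift 2 1 b : 'I_3).
pose h (M : quadruple K 3) := (\prod_(j < 3)
  (M (widen_ord (leqnSn 3) j) - 1%:M) (kk (widen_ord (leqnSn 3) j)) (@lshift 2 1 0 : 'I_3)) *
    \det (hd M).
have hE (M : quadruple K 3) (P : 'M[K]_(2 + 1, 2)) (Q : 'M[K]_(2, 2 + 1)) (u' : 'I_4 ->
  'cV[K]_2) v' :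
    (forall j, M j = 1%:M + P *m (u' j *m v' j) *m Q) ->
    h M = \prod_(j < 3) ((P *m u' (widen_ord (leqnSn 3) j)) (kk (widen_ord (leqnSn 3) j)) 0 *
        (v' (widen_ord (leqnSn 3) j) *m lsubmx Q) 0 0) *
      (\prod_(a < 2) (P *m u' (ii a)) (kk (ii a)) 0 *
       (\det (\matrix_(a, b) v' (ii a) 0 b) * \det (lsubmx Q))).
  move=> ME; have ent j l (b : 'I_2) : (M j - 1%:M) l (@lshift 2 1 b : 'I_3) =
      (P *m u' j) l 0 * (v' j *m lsubmx Q) 0 b.
    rewrite ME [1%:M + _]addrC addrK mulmxA -(mulmxA _ _ Q) mxE big_ord1; congr (_ * _).
    by rewrite !mxE; apply: eq_bigr => c _; rewrite mxE.
  rewrite /h; congr (_ * _); first by apply: eq_bigr => j _; rewrite ent.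
  have -> : hd M = diag_mx (\row_a (P *m u' (ii a)) (kk (ii a)) 0) *m
      ((\matrix_(a, b) v' (ii a) 0 b) *m lsubmx Q).
    apply/matrixP => a b; rewrite mul_diag_mx [LHS]mxE ent [RHS]mxE [in RHS]mxE.
    by congr (_ * _); rewrite !mxE; apply: eq_bigr => c _; rewrite mxE.
  rewrite !det_mulmx det_diag; congr (_ * _).
  by apply: eq_bigr => a _; rewrite mxE.
exists h; split.
- have alg := @polyfun_algebra K (quadruple K 3).
  have ent j : mx_algebra (@polyfun K _) (fun M : quadruple K 3 => M j - 1%:M).
    by apply: (mx_algebraB alg); [apply: polyfun_quadruple|apply: (mx_algebra_cst alg)].
  apply: (algebraM alg); first by apply: (algebra_prod alg) => j; apply: ent.
  by apply: (algebra_det alg) => a b; under eq_fun do rewrite mxE; apply: ent.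
- have zE' j : z j = 1%:M + (col_mx 1%:M 0 : 'M_(2 + 1,
  2)) *m (u j *m v j) *m (row_mx 1%:M 0 : 'M_(2, 2 + 1)).
    have E (N : 'M_2) : block_mx (1%:M + N) 0 0 1%:M =
        1%:M + col_mx 1%:M 0 *m N *m row_mx 1%:M 0 :> 'M[K]_(2 + 1).
      rewrite [X in _ = X + _]scalar_mx_block mul_col_mx mul1mx mul0mx.
      by rewrite mul_col_row !mulmx1 !mulmx0 ?mul0mx add_block_mx !addr0.
    by rewrite zE E.
  have Pu j : ((col_mx 1%:M 0 : 'M_(2 + 1, 2)) *m u j) (kk j) 0 != 0.
    by rewrite mul_col_mx mul1mx mul0mx /kk (@col_mxEu _ 2 1) uk.
  rewrite (hE _ _ _ _ _ zE') row_mxKl det1 mulr1 !mulf_neq0//; apply/prodf_neq0 => j _;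
    last exact: Pu.
  by rewrite mulf_neq0 ?Pu// mulmx1 v0.
have [g gE] := trace_defect_regular 9.
exists g, (@S_chart 9); split; [|exact: S_chart_regular|].
  by have [w] := trace_defect_neq0; rewrite gE; apply: contraNneq => ->; rewrite meval0.
move=> M SM hM; have [P [Q [u' [v' [QP vu' rA ME]]]]] := subset_S_form SM.
move: hM; rewrite (hE _ _ _ _ _ ME) !mulf_eq0 !negb_or => /and4P[/prodf_neq0 v'0 _ _ dQ].
pose G := lsubmx Q; have Gu : G \in unitmx by rewrite unitmxE unitfE.
pose Q' := invmx G *m Q; pose P' := P *m G.
pose u2 j := invmx G *m u' j; pose v2 j := v' j *m G.
have vu2 j : v2 j *m u2 j = (x j - 1)%:M by rewrite mulmxA mulmxK.
have PQE j : P' *m (u2 j *m v2 j) *m Q' = P *m (u' j *m v' j) *m Q.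
  by rewrite !mulmxA mulmxK// -!mulmxA mulKVmx.
have QP' : Q' *m P' = 1%:M by rewrite mulmxA -(mulmxA _ Q P) QP mulmx1 mulVmx.
pose q := rsubmx Q'; pose p := dsubmx P'.
have Q'E : Q' = row_mx 1%:M q.
  rewrite -[LHS]hsubmxK; congr row_mx.
  by rewrite /Q' -[Q]hsubmxK mul_mx_row row_mxKl mulVmx.
have P'E : P' = col_mx (1%:M - q *m p) p.
  rewrite -[LHS]vsubmxK; congr col_mx.
  by have := QP'; rewrite Q'E -{1}[P']vsubmxK mul_row_col mul1mx => <-; rewrite addrK.
pose A2 : quadruple K 2 := [ffun j => 1%:M + u2 j *m v2 j].
have rA2 : is_rep A2.
  have conj j : A2 j = invmx G *m (1%:M + u' j *m v' j) *m G.
    by rewrite ffunE mulmxDr mulmxDl mulmx1 mulVmx// !mulmxA.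
  move: rA; rewrite /is_rep !conj !ffunE => rA; rewrite !mulmxA !(mulmxK Gu).
  by rewrite -!(mulmxA (invmx G)) rA mul1mx mulVmx.
(* The first entry of the fourth row may vanish, so parameters are only claimed under a condition,
   with (0, 0) as default. *)
have /choice[ts tsE] j : exists ts : K * K, v2 j 0 0 != 0 ->
    u2 j *m v2 j = dual_col (0 : 'I_2) (x j) (fun=> ts.1) (fun=> ts.2) *m
      unit_row (0 : 'I_2) (fun=> ts.1).
  have [v20|v20] := eqVneq (v2 j 0 0) 0; first by exists (0, 0).
  by have [t [s E]] := refl_chart2 (vu2 j) v20; exists (t, s).
pose w (l : 'I_10) := [:: (ts (inord 0)).1; (ts (inord 0)).2; (ts (inord 1)).1;
  (ts (inord 1)).2;
  (ts (inord 2)).1; (ts (inord 2)).2; q ord0 0; q (lift ord0 ord0) 0; p 0 ord0;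
    p 0 (lift ord0 ord0)]`_l.
have A2E (j : nat) : (j < 3)%N ->
    plane_quad x (fun j => w (inord (2 * j))) (fun j => w (inord (2 * j).+1)) (inord j) = A2
      (inord j).
  move=> j3; rewrite plane_quad_first// ffunE tsE; last first.
    have := v'0 (Ordinal j3) isT; rewrite mulf_eq0 negb_or => /andP[_].
    by rewrite (_ : widen_ord _ _ = inord j)//; apply: val_inj; rewrite /= inordK// ltnW.
  congr (_ + dual_col _ _ _ _ *m unit_row _ _); apply/funext => _;
    by case: j j3 => [|[|[|]]]//= _; rewrite /w !inordK.
have qE : \col_i w (inord (6 + i)) = q.
  by apply/colP; apply: ord2_ind; rewrite mxE /w inordK.
have pE : \row_i w (inord (8 + i)) = p.
  by apply/rowP; apply: ord2_ind; rewrite mxE /w inordK.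
exists w.
  rewrite -gE /trace_defect !A2E// (rep_trace rA2 (vu2 _)) ?subrr//.
  by rewrite ffunE.
have frame j : (j < 3)%N -> S_chart w (inord j) = M (inord j).
  move=> j3; rewrite /S_chart /S_quad ffunE A2E// qE pE -P'E -Q'E ffunE.
  by rewrite (addrC 1%:M (u2 _ *m _)) addrK PQE -ME.
by apply: rep_last_eq; [exact: S_quad_rep|exact: SM.1.2|exact: frame..].
Qed.

End CoverS.

Lemma invmx_mul (K : comUnitRingType) n (A B : 'M[K]_n) : A \in unitmx -> B \in unitmx ->
  invmx (A *m B) = invmx B *m invmx A.
Proof.
move=> Au Bu; have ABu : A *m B \in unitmx by rewrite unitmx_mul Au.
by apply: (can_inj (mulKmx ABu)); rewrite mulmxV// mulmxA mulmxK// mulmxV.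
Qed.

(** * Reaching general position by conjugation *)

Section ConjugationS.
Variable K : numFieldType.

Definition conj_quad n (R : 'M[K]_n) (M : quadruple K n) : quadruple K n :=
  [ffun j => invmx R *m M j *m R].

Lemma conj_quad_linear n (R : 'M[K]_n) : linear (conj_quad R).
Proof.
move=> a M N; apply/ffunP => j; rewrite !ffunE mulmxDr mulmxDl.
by rewrite -scalemxAr -scalemxAl.
Qed.
HB.instance Definition _ n (R : 'M[K]_n) :=
  GRing.isLinear.Build _ _ _ _ (conj_quad R) (conj_quad_linear R).

Lemma conj_quadK n (R : 'M[K]_n) : R \in unitmx -> cancel (conj_quad R) (conj_quad (invmx R)).
Proof.
move=> Ru M; apply/ffunP => j; rewrite !ffunE invmxK.
by rewrite !mulmxA mulmxV// mul1mx mulmxK.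
Qed.

Lemma conj_quad_rep n (R : 'M[K]_n) M : R \in unitmx -> is_rep M -> is_rep (conj_quad R M).
Proof.
move=> Ru rM; rewrite /is_rep !ffunE !mulmxA !(mulmxK Ru).
by rewrite -!(mulmxA (invmx R)) rM mul1mx mulVmx.
Qed.

Lemma conj_quad_S (C : 'I_4 -> set 'M[K]_3) (R : 'M[K]_3) M :
  (forall j N, C j N -> C j (invmx R *m N *m R)) ->
  R \in unitmx -> subset_S C M -> subset_S C (conj_quad R M).
Proof.
move=> Cconj Ru [[CM rM] [A [B [irrA rB [P Pu ME]]]]]; split.
  by split; [move=> j; rewrite ffunE; apply: Cconj|apply: conj_quad_rep].
exists A, B; split=> //; exists (invmx R *m P); first by rewrite unitmx_mul unitmx_inv Ru.
by move=> j; rewrite ffunE ME invmx_mul ?invmxK ?unitmx_inv// !mulmxA.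
Qed.

Lemma reflection_class_conj (a : K) (R : 'M[K]_3) M : R \in unitmx ->
  reflection_class a M -> reflection_class a (invmx R *m M *m R).
Proof.
move=> Ru [P Pu ->]; exists (invmx R *m P); first by rewrite unitmx_mul unitmx_inv Ru.
by rewrite invmx_mul ?invmxK ?unitmx_inv// !mulmxA.
Qed.

Lemma det_mx2 (X : 'M[K]_2) : \det X =
  X ord0 ord0 * X (lift ord0 ord0) (lift ord0 ord0)
  - X ord0 (lift ord0 ord0) * X (lift ord0 ord0) ord0.
Proof.
rewrite (expand_det_row _ ord0) !big_ord_recl big_ord0 /cofactor !det_mx11 !mxE /=.
have -> : lift (lift ord0 ord0) (0 : 'I_1) = ord0 :> 'I_2 by apply: val_inj.
by rewrite expr0 expr1; ring.
Qed.

(** Each expression is a nonzero polynomial in [m], and so is the product of all of them. *)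
Lemma shear_generic (I : finType) (v : I -> 'rV[K]_2) : (forall i, v i != 0) ->
  exists m, forall i, v i 0 ord0 + m * v i 0 (lift ord0 ord0) != 0.
Proof.
move=> v0; pose p i : {mpoly K[1]} := (v i 0 ord0)%:MP + v i 0 (lift ord0 ord0) *: 'X_0.
have pE i w : (p i).@[w] = v i 0 ord0 + w 0 * v i 0 (lift ord0 ord0).
  by rewrite mevalD mevalC mevalZ mevalXU mulrC.
have /mpoly_neq0_meval[w] : \prod_i p i != 0.
  apply/prodf_neq0 => i _; apply: contraNneq (v0 i) => pi0.
  have := pE i (fun=> 0); have := pE i (fun=> 1); rewrite pi0 !meval0 mul1r mul0r addr0 => + e0.
  rewrite -e0 add0r => e1; apply/eqP/rowP; apply: ord2_ind; by rewrite mxE -?e0 -?e1.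
rewrite rmorph_prod /= => /prodf_neq0 wP; exists (w 0) => i.
by rewrite -pE; apply: wP.
Qed.

Variable x : 'I_4 -> K.
Hypotheses (x0 : forall j, x j != 0) (x1 : forall j, x j != 1).
Hypothesis prod_x : x (inord 0) * x (inord 1) * x (inord 2) * x (inord 3) = 1.
Let C j := reflection_class (x j).

Lemma subset_S_covered z : subset_S C z -> covered_near 9 (subset_S C) z.
Proof.
move=> /[dup] Sz /subset_S_structure[R [A [u [v [Ru irrA vu AE zE]]]]].
have v_neq0 j : v j != 0 by have [] := rank1_neq0 (x1 j) (vu j).
have [m vm] := shear_generic v_neq0.
pose G : 'M[K]_2 := \matrix_(i, j) if i == j then 1 else if j == 0 then m else 0.
have detG : \det G = 1.
  by rewrite det_mx2 !mxE /= mulr1 mul0r subr0.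
have Gu : G \in unitmx by rewrite unitmxE detG unitr1.
pose D : 'M[K]_(2 + 1) := block_mx G 0 0 1%:M.
have DV : D *m block_mx (invmx G) 0 0 1%:M = 1%:M.
  by rewrite mulmx_block !mulmx0 !mul0mx !addr0 add0r mulmxV// mulmx1 -scalar_mx_block.
have Du := (mulmx1_unit DV).1.
have DE : invmx D = block_mx (invmx G) 0 0 1%:M.
  by rewrite -[LHS]mulmx1 -DV mulmxA mulVmx// mul1mx.
pose R' : 'M[K]_3 := R *m D.
have R'u : R' \in unitmx by rewrite unitmx_mul Ru Du.
pose u' j := invmx G *m u j; pose v' j := v j *m G.
have blkE j : invmx D *m block_mx (A j) 0 0 1%:M *m D = block_mx (1%:M + u' j *m v' j) 0 0 1%:M.
  rewrite DE /D !mulmx_block !mulmx0 !mul0mx !addr0 !add0r !mulmx1 AE mulmxDr mulmxDl.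
  by rewrite mulmx1 mulVmx// !mulmxA mul0mx.
have z'E j : conj_quad R' z j = block_mx (1%:M + u' j *m v' j) 0 0 1%:M :> 'M_(2 + 1).
  by rewrite -blkE ffunE zE /R' invmx_mul// !mulmxA mulmxKV// mulmxKV.
have vu' j : v' j *m u' j = (x j - 1)%:M by rewrite mulmxA mulmxK.
have v'0 (j : 'I_3) : v' (widen_ord (leqnSn 3) j) 0 0 != 0.
  by rewrite /v' mulmx2E !mxE /= mulr1 [_ * m]mulrC vm.
have [i di] : exists i, \det (\matrix_(a,
  b) v' (if a == 0 then inord 0 else i) 0 b : 'M_2) != 0.
  apply: contrapT => H.
  (* This vector spans the kernel of v_0. If every v_i were parallel to v_0, all the A_i would fix
     it, against irreducibility. *)
  pose w : 'cV[K]_2 := \col_i if i == 0 then - v (inord 0) 0 (lift ord0 ord0) else v (inord 0)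
    0 ord0.
  have w0 : w != 0.
    apply: contraNneq (v_neq0 (inord 0)) => w0; apply/eqP/rowP; apply: ord2_ind.
      by have /colP/(_ (lift ord0 ord0)) := w0; rewrite !mxE /= => ->.
    by have /colP/(_ ord0) := w0; rewrite !mxE /= => /eqP; rewrite oppr_eq0 => /eqP.
  apply: (irreducible_no_eigenvector irrA w0) => i; exists 1.
  rewrite AE mulmxDl mul1mx scale1r -mulmxA (_ : v i *m w = 0) ?mulmx0 ?addr0//.
  rewrite [LHS]mx11_scalar mulmx2E !mxE /=.
  have /negP/negPn/eqP : ~ (\det (\matrix_(a,
    b) v' (if a == 0 then inord 0 else i) 0 b : 'M_2) != 0).
    by move=> di; apply: H; exists i.
  have -> : \matrix_(a, b) v' (if a == 0 then inord 0 else i) 0 b =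
      (\matrix_(a, b) v (if a == 0 then inord 0 else i) 0 b : 'M_2) *m G.
    apply/matrixP => a b; rewrite !mxE; apply: eq_bigr => c _. by congr (_ * _); rewrite mxE.
  rewrite det_mulmx detG mulr1 det_mx2 !mxE /= => d0.
  by rewrite mulrN addrC [X in X - _]mulrC [X in _ - X]mulrC d0 raddf0.
have cov := subset_S_covered_split x0 x1 prod_x vu' z'E v'0 di.
apply: (@covered_near_pullback K _ _ 9 _ _ (conj_quad R') (conj_quad (invmx R')) z _ _ cov).
  exact: conj_quadK.
by move=> M; apply: conj_quad_S => // j N; apply: reflection_class_conj.
Qed.

End ConjugationS.

(** * Criteria for membership in the set of direct sums *)

Section MembershipS.
Variable K : numFieldType.

Lemma reflection_class_rank1 (a : K) (u : 'cV[K]_3) (v : 'rV[K]_3) : a != 1 ->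
  v *m u = (a - 1)%:M -> reflection_class a (1%:M + u *m v).
Proof.
move=> a1 vu; have [_ v0] := rank1_neq0 a1 vu.
have [k vk] := rV0Pn _ v0.
have [|u' [v' [v'k + <-]]] := @rank1_normalize K 3 3 k (a - 1) u 1%:M v vk;
  rewrite !mul1mx// => v'u'.
pose T : 'M[K]_3 := tperm_mx 0 k.
have Tu : T \in unitmx by exact: unitmx_perm.
have -> : 1%:M + u' *m v' = invmx (invmx T) *m (1%:M + (invmx T *m u') *m (v' *m T)) *m invmx T.
  rewrite invmxK mulmxDr mulmxDl mulmx1 mulmxV// !mulmxA mulmxV// mul1mx.
  by rewrite mulmxK.
apply: reflection_class_conj; first by rewrite unitmx_inv.
apply: reflection_classI => //; first by rewrite -xcolE mxE perm.tpermL.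
by rewrite mulmxA mulmxK.
Qed.

Lemma det0_rank1 (X : 'M[K]_2) : \det X = 0 -> exists (u : 'cV_2) (v : 'rV_2), X = u *m v.
Proof.
move=> dX; have : (\rank X <= 1)%N.
  by rewrite -ltnS ltn_neqAle rank_leq_row andbT -/(row_free X) row_free_unit unitmxE dX unitr0.
case: (posnP (\rank X)) => [/eqP|r0 r1].
  by rewrite mxrank_eq0 => /eqP-> _; exists 0, 0; rewrite mul0mx.
have : \rank X = 1%N by apply/eqP; rewrite eqn_leq r1.
move: (col_base X) (row_base X) (mulmx_base X) => c r E rk.
by move: c r E; rewrite rk => c r <-; exists c, r.
Qed.

(** A proper nonzero invariant subspace of the plane is spanned by a common eigenvector, which every
    commutator kills. The criterion is a polynomial inequation, as a chart requires. *)
Lemma commutator_irreducible (A : quadruple K 2) i j : is_rep A ->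
  \det (A i *m A j - A j *m A i) != 0 -> irreducible_rep A.
Proof.
move=> rA dA; split=> // U Uinv; have [->|U0] := eqVneq U 0%VS; [by left|right].
apply/eqP; rewrite eqEdim subvf /= dimvf /dim /= muln1.
rewrite ltnNge; apply/negP => dU.
have w0 : vpick U != 0 by rewrite vpick0.
have UE : U = <[vpick U]>%VS.
  by apply/esym/eqP; rewrite eqEdim -memvE memv_pick dim_vline w0.
have eig l : exists c, A l *m vpick U = c *: vpick U.
  have := Uinv l _ (memv_pick U); rewrite {2}UE => /vlineP[c ->]; by exists c.
have [[ci Ei] [cj Ej]] := (eig i, eig j).
have Nu : A i *m A j - A j *m A i \in unitmx by rewrite unitmxE unitfE.
case/eqP: w0; apply: (can_inj (mulKmx Nu)); rewrite mulmx0 mulmxBl -!mulmxA Ei Ej.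
by rewrite -!scalemxAr Ei Ej !scalerA mulrC subrr.
Qed.

Variable x : 'I_4 -> K.
Hypotheses (x0 : forall j, x j != 0) (x1 : forall j, x j != 1).
Hypothesis prod_x : x (inord 0) * x (inord 1) * x (inord 2) * x (inord 3) = 1.
Let C j := reflection_class (x j).

(** Let N = A_0 A_1 A_2. Its determinant is 1/x_3 by [prod_x] and its trace is 1 + 1/x_3, so det (N
    - 1) = det N - tr N + 1 = 0. Hence N = 1 + u v with v u = 1/x_3 - 1, and A_3, the inverse of N,
    is a reflection of ratio x_3. *)
Lemma plane_quad_frame t s : trace_defect x t s = 0 -> forall j,
  exists (u : 'cV_2) (v : 'rV_2), v *m u = (x j - 1)%:M /\ plane_quad x t s j = 1%:M + u *m v.
Proof.
set A := plane_quad x t s => td.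
have first j : (j < 3)%N -> exists (u : 'cV_2) (v : 'rV_2),
    v *m u = (x (inord j) - 1)%:M /\ A (inord j) = 1%:M + u *m v.
  move=> j3; rewrite /A plane_quad_first//.
  exists (dual_col 0 (x (inord j)) (fun=> t (inord j)) (fun=> s (inord j))),
    (unit_row 0 (fun=> t (inord j))).
  by split=> //; apply: unit_row_dual.
apply: ord4_ind; do ?[exact: first].
have detA j : (j < 3)%N -> \det (A (inord j)) = x (inord j).
  by move=> j3; rewrite /A plane_quad_first// det_mx2 !plane_matrixE /=; ring.
have rA : is_rep A by exact: plane_quad_rep.
pose N := A (inord 0) *m A (inord 1) *m A (inord 2).
have detN : \det N = (x (inord 3))^-1.
  by rewrite !det_mulmx !detA//; apply: (mulIf (x0 (inord 3))); rewrite prod_x mulVf.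
have trN : \tr N = 1 + (x (inord 3))^-1 by apply/eqP; rewrite -subr_eq0; apply/eqP.
have [|u [v NE]] := @det0_rank1 (N - 1%:M).
  have -> : \det (N - 1%:M) = \det N - \tr N + 1.
    by rewrite !det_mx2 mxtrace2 !mxE /=; ring.
  by rewrite detN trN; ring.
have vu : v *m u = ((x (inord 3))^-1 - 1)%:M.
  rewrite [LHS]mx11_scalar; congr _%:M; rewrite -[LHS]mulr1n -mxtrace_scalar -mx11_scalar.
  by rewrite mxtrace_mulC -NE linearB /= trN mxtrace1; ring.
have E := reflection_mulV (invr_neq0 (x0 _)) vu.
exists (- x (inord 3) *: u), v; split.
  rewrite -scalemxAr vu scale_scalar_mx; congr _%:M; field; exact: x0.
have Nu := (mulmx1_unit rA).1; apply: (can_inj (mulKmx Nu)).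
rewrite [LHS]rA -/N -scalemxAl scaleNr; move: E.
by rewrite -NE [X in X *m _]addrC subrK invrK => ->.
Qed.

Lemma S_quad_in t s q p : trace_defect x t s = 0 ->
  \det (plane_quad x t s (inord 0) *m plane_quad x t s (inord 1)
      - plane_quad x t s (inord 1) *m plane_quad x t s (inord 0)) != 0 ->
  subset_S C (S_quad x t s q p).
Proof.
move=> td dA; have rA := plane_quad_rep x0 t s; split.
  split; last exact: S_quad_rep.
  move=> j; rewrite ffunE; have [u [v [vu ->]]] := plane_quad_frame td j.
  rewrite (addrC 1%:M (u *m v)) addrK mulmxA -(mulmxA _ _ (row_mx _ _)).
  apply: reflection_class_rank1 => //.
  by rewrite mulmxA -(mulmxA v) splitting_dual mulmx1.
exists (plane_quad x t s), [ffun=> 1%:M]; split.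
- exact: commutator_irreducible rA dA.
- by rewrite /is_rep !ffunE !mulmx1.
(* The first two columns of [R] form P and the last one, (-q, 1), spans the kernel of Q; the first
   two rows of the inverse [R'] form Q. *)
pose R : 'M[K]_(2 + 1) := block_mx (1%:M - q *m p) (- q) p 1%:M.
pose R' : 'M[K]_(2 + 1) := block_mx 1%:M q (- p) (1%:M - p *m q).
have RR' : R *m R' = 1%:M.
  rewrite mulmx_block !(mulmx1, mul1mx, mulNmx, mulmxN, opprK).
  rewrite [RHS]scalar_mx_block; congr block_mx.
  - exact: subrK.
  - by rewrite mulmxBl mulmxBr mul1mx mulmx1 mulmxA; apply: subrr.
  - exact: subrr.
  - by rewrite addrC; apply: subrK.
have Ru := (mulmx1_unit RR').1.
have R'E : invmx R = R' by rewrite -[LHS]mulmx1 -RR' mulmxA mulVmx// mul1mx.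
exists R => // j; rewrite R'E /S_quad /direct_sum; set A := plane_quad x t s.
rewrite ffunE [in RHS]ffunE [X in block_mx _ _ _ X]ffunE; move: (A j) => {}A.
have -> : block_mx A 0 0 1%:M = 1%:M + col_mx 1%:M 0 *m (A - 1%:M) *m row_mx 1%:M 0 :> 'M_(2 +
  1).
  rewrite [X in _ = X + _]scalar_mx_block mul_col_mx mul1mx mul0mx.
  by rewrite mul_col_row !mulmx1 !mulmx0 ?mul0mx add_block_mx !addr0 addrC subrK.
rewrite (mulmxDr R) mulmxDl mulmx1 RR' !mulmxA -[in RHS](mulmxA _ (row_mx _ _) R').
congr (_ + _ *m _ *m _).
  by rewrite mul_block_col !mulmx0 !mulmx1 !addr0.
by rewrite mul_row_block !mul0mx !mul1mx !addr0.
Qed.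

End MembershipS.

(** * A chart of direct sums, with the trace equation solved *)

Section DimensionS.
Variables (K : numFieldType) (x : 'I_4 -> K).
Hypotheses (x0 : forall j, x j != 0) (x1 : forall j, x j != 1).
Hypothesis prod_x : x (inord 0) * x (inord 1) * x (inord 2) * x (inord 3) = 1.
Let C j := reflection_class (x j).

Let o0 : 'I_2 := ord0.
Let o1 : 'I_2 := lift ord0 ord0.
Let e0 : 'I_3 := @lshift 2 1 o0.
Let e1 : 'I_3 := @lshift 2 1 o1.
Let e2 : 'I_3 := @rshift 2 1 ord0.

Lemma S_quad_entry t s (q : 'cV[K]_2) (p : 'rV[K]_2) j :
  let X := plane_quad x t s j - 1%:M in
  let pX l := p 0 o0 * X o0 l + p 0 o1 * X o1 l in
  let Y i l := X i l - q i 0 * pX l in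
  [/\ forall i l, S_quad x t s q p j (@lshift 2 1 i) (@lshift 2 1 l) = (i == l)%:R + Y i l,
      forall i, S_quad x t s q p j (@lshift 2 1 i) e2 = Y i o0 * q o0 0 + Y i o1 * q o1 0 &
      forall l, S_quad x t s q p j e2 (@lshift 2 1 l) = pX l].
Proof.
move=> X pX Y; rewrite /S_quad ffunE -/X.
have YE i l : ((1%:M - q *m p) *m X) i l = Y i l.
  rewrite mulmxBl mul1mx -mulmxA [LHS]mxE; congr (_ + _); rewrite mxE; congr (- _).
  by rewrite mxE big_ord1 mulmx2E.
have -> : 1%:M + col_mx (1%:M - q *m p) p *m X *m row_mx 1%:M q =
    block_mx (1%:M + (1%:M - q *m p) *m X) ((1%:M - q *m p) *m X *m q) (p *m X) (1%:M + p *m X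
      *m q).
  rewrite [X in X + _ = _]scalar_mx_block mul_col_mx mul_col_row !mulmx1 add_block_mx.
  by rewrite !add0r.
split=> [i l|i|l].
- by rewrite (@block_mxEul _ 2 1 2 1) mxE YE mxE.
- by rewrite (@block_mxEur _ 2 1 2 1) mulmx2E !YE.
- by rewrite (@block_mxEdl _ 2 1 2 1) mulmx2E.
Qed.

(** The coordinates are t_0, s_0, t_1, s_1, t_2, then the two entries of q and the two of p. None is
    left for s_2: [sw] at index 2 reads the first entry of q, and the chart puts the solution of the
    trace equation in its place. *)
Let tw (w : 'I_9 -> K) (j : 'I_4) := w (inord (2 * j)).
Let sw (w : 'I_9 -> K) (j : 'I_4) := w (inord (2 * j).+1).
Let qw (w : 'I_9 -> K) : 'cV[K]_2 := \col_i w (inord (5 + i)).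
Let pw (w : 'I_9 -> K) : 'rV[K]_2 := \row_i w (inord (7 + i)).

Let PA (w : 'I_9 -> K) j := plane_quad x (tw w) (sw w) (inord j).

Let B w := PA w 0 *m PA w 1.

(* The trace condition of [plane_quad_frame] is affine in s_2, with value
   [value] at s_2 = 0; off [slope] = 0 it can be solved for s_2. *)
Let slope w : K := B w o0 o1 + w (inord 4) * (B w o1 o1 - B w o0 o0) - w (inord 4) ^+ 2 * B w
  o1 o0.
Let value w : K := B w o0 o0 * x (inord 2) + B w o1 o0 * (x (inord 2) - 1) * w (inord 4) + B w
  o1 o1
  - (1 + (x (inord 3))^-1).
Let comm w : K := \det (PA w 0 *m PA w 1 - PA w 1 *m PA w 0).

Lemma PA_regular (q : {mpoly K[9]}) (j : nat) : mx_algebra (regular q) (fun w => PA w j).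
Proof.
have alg := regular_algebra q.
by apply: (@plane_quad_algebra K x _ _ (fun j w => tw w j) (fun j w => sw w j)) => // i;
  apply: regular_coord.
Qed.

Lemma slope_comm_poly : exists q : {mpoly K[9]}, forall w, slope w * comm w = q.@[w].
Proof.
have alg := regular_algebra (1 : {mpoly K[9]}).
have P0 : mx_algebra (regular (1 : {mpoly K[9]})) (fun w => PA w 0) := PA_regular 1 0.
have P1 : mx_algebra (regular (1 : {mpoly K[9]})) (fun w => PA w 1) := PA_regular 1 1.
have rB : mx_algebra (regular (1 : {mpoly K[9]})) B by apply: (mx_algebraM alg).
have rBe i j : regular (1 : {mpoly K[9]}) (fun w => B w i j) by exact: (rB i j).
have w4 : regular (1 : {mpoly K[9]}) (fun w => w (inord 4)) by apply: regular_coord.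
apply: regular1P; apply: (algebraM alg).
  apply: (algebraB alg).
    apply: (algebraD alg); first exact: rBe.
    by apply: (algebraM alg) => //; apply: (algebraB alg); apply: rBe.
  by apply: (algebraM alg); [apply: (algebraX alg)|apply: rBe].
apply: (algebra_det alg); apply: (mx_algebraB alg); exact: (mx_algebraM alg).
Qed.

Lemma value_regular q : regular q value.
Proof.
have alg := regular_algebra q.
have cst c : regular q (fun=> c) by exact: (algebra_cst alg).
have P0 : mx_algebra (regular q) (fun w => PA w 0) := PA_regular q 0.
have P1 : mx_algebra (regular q) (fun w => PA w 1) := PA_regular q 1.
have rB : mx_algebra (regular q) B by apply: (mx_algebraM alg).
have rBe i j : regular q (fun w => B w i j) by exact: (rB i j).
have w4 : regular q (fun w => w (inord 4)) by apply: regular_coord.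
apply: (algebraB alg) => //; apply: (algebraD alg); last exact: rBe.
apply: (algebraD alg); first by apply: (algebraM alg); first exact: rBe.
by apply: (algebraM alg) => //; apply: (algebraM alg) => //; apply: rBe.
Qed.

Lemma comm_regular q : regular q comm.
Proof.
have alg := regular_algebra q.
have P0 : mx_algebra (regular q) (fun w => PA w 0) := PA_regular q 0.
have P1 : mx_algebra (regular q) (fun w => PA w 1) := PA_regular q 1.
apply: (algebra_det alg); apply: (mx_algebraB alg); exact: (mx_algebraM alg).
Qed.

(** With sigma = (x_1 - 1)/2, A_0 is diag(x_0, 1) and A_1 has diagonal entries 1 + sigma and the
    others sigma; t_2, q and p are 0. The commutator has determinant (x_0 - 1)^2 sigma^2, and the
    slope is x_0 sigma. *)
Let w0 (l : 'I_9) : K := [:: 0; 0; 1; (x (inord 1) - 1) / 2; 0]`_l.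

Lemma subset_S_chain : exists Z, irreducible_chain (subset_S C) 9 Z.
Proof.
have [q qE] := slope_comm_poly.
(* This is - value / slope. The polynomial [q] is slope times [comm], so that its nonvanishing also
   guarantees irreducibility; the factor [comm] in the numerator compensates. *)
pose s2 w := - value w * comm w * (q.@[w])^-1.
pose sol (w : 'I_9 -> K) (j : 'I_4) := if j == inord 2 then s2 w else sw w j.
pose phi w : quadruple K 3 := S_quad x (tw w) (sol w) (qw w) (pw w).
(* [psi] has a wrong s_2 but no denominator, and agrees with [phi] on the first two matrices;
   separating functions of these two can be computed on it. *)
pose psi w : quadruple K 3 := S_quad x (tw w) (sw w) (qw w) (pw w).
have rphi : regular_map q phi.
  apply: regular_map_quadruple => j.
  apply: (@S_quad_algebra K x _ _ (fun j w => tw w j) (fun j w => sol w j)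
    (fun i w => w (inord (5 + i))) (fun i w => w (inord (7 + i)))).
  - exact: regular_algebra.
  - by move=> i; apply: regular_coord.
  - move=> i; rewrite /sol; case: (i == _); last exact: regular_coord.
    have alg := regular_algebra q.
    apply: (algebraM alg); last exact: regularV.
    by apply: (algebraM alg); [apply: (algebraN alg); apply: value_regular|apply: comm_regular].
  - by move=> i; apply: regular_coord.
  - by move=> i; apply: regular_coord.
have rpsi : regular_map 1 psi.
  apply: regular_map_quadruple => j.
  apply: (@S_quad_algebra K x _ _ (fun j w => tw w j) (fun j w => sw w j)
    (fun i w => w (inord (5 + i))) (fun i w => w (inord (7 + i)))).
  - exact: regular_algebra.
  - by move=> i; apply: regular_coord.
  - by move=> i; apply: regular_coord.
  - by move=> i; apply: regular_coord.
  - by move=> i; apply: regular_coord.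
have PAsol w j : (j < 2)%N -> plane_quad x (tw w) (sol w) (inord j) = PA w j.
  move=> j2; rewrite /PA !plane_quad_first ?(ltn_trans j2)// /sol.
  by rewrite ifN//; apply/eqP => /(congr1 val); rewrite /= !inordK ?(ltn_trans j2)// => j2';
    move: j2; rewrite j2'.
have phipsi w j : (j < 2)%N -> phi w (inord j) = psi w (inord j).
  by move=> j2; rewrite /phi /psi /S_quad [LHS]ffunE [RHS]ffunE PAsol.
have s2E w : q.@[w] != 0 -> value w + s2 w * slope w = 0.
  rewrite /s2 -qE mulf_eq0 negb_or => /andP[sl cm]; field; by rewrite sl cm.
have td w : q.@[w] != 0 -> trace_defect x (tw w) (sol w) = 0.
  move=> /s2E <-; rewrite /trace_defect (PAsol w 0)// (PAsol w 1)// -/(B w) plane_quad_first//.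
  rewrite mxtrace2 !mulmx2E !plane_matrixE /= /sol eqxx /tw inordK// /value /slope.
  rewrite (_ : (2 * 2)%N = 4)// /B !mulmx2E -/o0 -/o1; ring.
have cm w : q.@[w] != 0 -> comm w != 0.
  by rewrite -qE mulf_eq0 negb_or => /andP[].
have w0E k : (k < 9)%N -> w0 (inord k) = [:: 0; 0; 1; (x (inord 1) - 1) / 2; 0]`_k.
  by move=> k9; rewrite /w0 inordK.
have x10 j : x j - 1 != 0 by rewrite subr_eq0.
pose sigma := (x (inord 1) - 1) / 2.
have sigma0 : sigma != 0 by rewrite mulf_neq0 ?invr_neq0 ?pnatr_eq0.
have PA0 w : w (inord 0) = 0 -> w (inord 1) = 0 -> forall i j, PA w 0 i j =
    if i == 0 then (if j == 0 then x (inord 0) else 0) else (if j == 0 then 0 else 1).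
  move=> t0 s0 i j; rewrite /PA plane_quad_first// plane_matrixE /tw /sw !inordK// t0 s0.
  by case: (i == 0); case: (j == 0); ring.
have PA1 w : w (inord 2) = 1 -> w (inord 3) = sigma -> forall i j, PA w 1 i j =
    if i == j then 1 + sigma else sigma.
  move=> t0 s0 i j; rewrite /PA plane_quad_first// plane_matrixE /tw /sw !inordK// t0 s0.
  have -> : x (inord 1) = 1 + sigma + sigma by rewrite /sigma; field.
  by elim/ord2_ind: i; elim/ord2_ind: j => /=; ring.
have comm0 w : w (inord 0) = 0 -> w (inord 1) = 0 -> w (inord 2) = 1 -> w (inord 3) = sigma ->
    comm w != 0.
  move=> t0 s0 t1 s1; rewrite /comm det_mx2 !mxE !big_ord_recl !big_ord0.
  rewrite !PA0// !PA1//=.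
  have : (x (inord 0) - 1) ^+ 2 * sigma ^+ 2 != 0 by rewrite mulf_neq0 ?expf_neq0.
  by congr (_ != 0); ring.
have slope0 w : w (inord 0) = 0 -> w (inord 1) = 0 -> w (inord 2) = 1 -> w (inord 3) = sigma ->
    slope w = x (inord 0) * sigma + w (inord 4) * ((1 + sigma) * (1 - x (inord 0))) - w (inord
      4) ^+ 2 * sigma.
  move=> t0 s0 t1 s1; rewrite /slope /B !mulmx2E !PA0// !PA1//=; ring.
have qw0 : q.@[w0] != 0.
  rewrite -qE mulf_neq0 ?comm0 ?slope0 ?w0E//=.
  have : x (inord 0) * sigma != 0 by rewrite mulf_neq0.
  by congr (_ != 0); ring.
apply: (@chain_of_chart K _ 9 _ q phi w0 rphi _ qw0).
  move=> w qwn; apply: S_quad_in => //; first exact: td.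
  by rewrite !(PAsol w 0)// !(PAsol w 1)//; apply: cm.
have psiE w j : psi w (inord j) = S_quad x (tw w) (sw w) (qw w) (pw w) (inord j) by exact:
  erefl.
have phiE w j : phi w (inord j) = S_quad x (tw w) (sol w) (qw w) (pw w) (inord j) by exact:
  erefl.
clearbody phi psi.
have ent (s : 'I_4 -> K) w j :
    let X a b := plane_quad x (tw w) s (inord j) a b - (a == b)%:R in
    let pX b := w (inord 7) * X o0 b + w (inord 8) * X o1 b in
    let Y (a : 'I_2) b := X a b - w (inord (5 + a)) * pX b in
    let M := S_quad x (tw w) s (qw w) (pw w) (inord j) in
    [/\ forall a b, M (@lshift 2 1 a) (@lshift 2 1 b) = (a == b)%:R + Y a b,
      forall a, M (@lshift 2 1 a) e2 = Y a o0 * w (inord 5) + Y a o1 * w (inord 6) &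
      forall b, M e2 (@lshift 2 1 b) = pX b].
  have [h1 h2 h3] := S_quad_entry (tw w) s (qw w) (pw w) (inord j).
  have XE a b : (plane_quad x (tw w) s (inord j) - 1%:M) a b =
      plane_quad x (tw w) s (inord j) a b - (a == b)%:R.
    by rewrite mxE; congr (_ + _); rewrite mxE; congr (- _); rewrite mxE.
  have qE' a : qw w a 0 = w (inord (5 + a)) by rewrite mxE.
  have pE' a : pw w 0 a = w (inord (7 + a)) by rewrite mxE.
  split=> [a b|a|b]; first by rewrite h1 !XE qE' !pE'.
    by rewrite h2 !XE !qE' !pE'.
  by rewrite h3 !XE !pE'.
have plE w s j a b : (j < 3)%N -> plane_quad x (tw w) s (inord j) a b =
    let T := w (inord (2 * j)) in let S := s (inord j) in
    if a == 0 then (if b == 0 then x (inord j) - T * S else (x (inord j) - 1 - T * S) * T)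
    else (if b == 0 then S else 1 + S * T).
  by move=> j3; rewrite plane_quad_first// plane_matrixE /tw inordK// ltnW.
have sw0 w : sw w (inord 0) = w (inord 1) by rewrite /sw inordK.
have sw1 w : sw w (inord 1) = w (inord 3) by rewrite /sw inordK.
have palg := @polyfun_algebra K (quadruple K 3).
have pe j a b : polyfun (fun M : quadruple K 3 => M j a b) by exact: polyfun_quadruple.
have pc c : polyfun (fun _ : quadruple K 3 => c) by exact: (algebra_cst palg).
pose e (i k : 'I_9) : K := w0 k + (k == i)%:R.
have Le (i : 'I_9) : coord_flat w0 i.+1 (e i).
  by move=> k ik; rewrite /e eqE /= gtn_eqF ?addr0.
have eE (i : 'I_9) k : (k < 9)%N -> e i (inord k) = [:: 0; 0; 1; (x (inord 1) - 1) / 2;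
  0]`_k + (k == i)%:R.
  by move=> k9; rewrite /e w0E// eqE /= inordK.
have flatE (i : 'I_9) w k : coord_flat w0 i w -> (i <= k < 9)%N -> w (inord k) = [:: 0; 0; 1;
  (x (inord 1) - 1) / 2; 0]`_k.
  by move=> Lw /andP[ik k9]; rewrite Lw ?w0E// inordK.
have simple (i : 'I_9) F : polyfun F -> (forall w, F (phi w) = F (psi w)) ->
    (forall w, coord_flat w0 i w -> F (psi w) = 0) -> F (psi (e i)) != 0 ->
    exists (F : quadruple K 3 -> K) f, [/\ polyfun F, regular 1 f,
      forall w, coord_flat w0 i w -> q.@[w] != 0 -> F (phi w) = 0,
      forall w, q.@[w] != 0 -> f w != 0 -> F (phi w) != 0 &
      exists2 w, coord_flat w0 i.+1 w & f w != 0].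
  move=> pF Fpsi F0 Fe; exists F, (fun w => F (psi w)); split.
  - exact: pF.
  - exact: (rpsi _ pF).
  - by move=> w Lw _; rewrite Fpsi; apply: F0.
  - by move=> w _ fw; rewrite Fpsi; exact: fw.
  - exact: (ex_intro2 _ _ (e i) (Le i) Fe).
have bE : x (inord 1) = 1 + sigma + sigma by rewrite /sigma; field.
have neq_sa : - sigma * (x (inord 0) - 1) != 0 by rewrite mulf_neq0 ?oppr_eq0.
case=> [[|[|[|[|[|[|[|[|[|//]]]]]]]]] lti].
(* For the first five coordinates q and p are still 0, and the upper left block of M_j is A_j. This
   entry is (x_0 - 1 - t_0 s_0) t_0. *)
- apply: (simple _ (fun M => M (inord 0) e0 e1)).
  + exact: pe.
  + by move=> w; rewrite ?phipsi.
  + move=> w /flatE Lw; have [l0 r0 b0] := ent (sw w) w 0%N;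
    have [l1 r1 b1] := ent (sw w) w 1%N.
    rewrite ?psiE ?(l0, r0, b0, l1, r1,
      b1) ?plE// ?sw0 ?sw1 ?(Lw 0%N isT) ?(Lw 1%N isT) ?(Lw 2%N isT) ?(Lw 3%N isT) ?(Lw 4%N
      isT) ?(Lw 5%N isT) ?(Lw 6%N isT) ?(Lw 7%N isT) ?(Lw 8%N isT) /= -/sigma; ring.
  + have [l0 r0 b0] := ent (sw (e (Ordinal lti))) (e (Ordinal lti)) 0%N;
    have [l1 r1 b1] := ent (sw (e (Ordinal lti))) (e (Ordinal lti)) 1%N.
    rewrite ?psiE ?(l0, r0, b0, l1, r1, b1) ?plE// ?sw0 ?sw1 !eE//= -/sigma ?bE.
    have : x (inord 0) - 1 != 0 by exact: x10.
    by congr (_ != 0); ring.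
- apply: (simple _ (fun M => M (inord 0) e1 e0)).
  + exact: pe.
  + by move=> w; rewrite ?phipsi.
  + move=> w /flatE Lw; have [l0 r0 b0] := ent (sw w) w 0%N;
    have [l1 r1 b1] := ent (sw w) w 1%N.
    rewrite ?psiE ?(l0, r0, b0, l1, r1,
      b1) ?plE// ?sw0 ?sw1 ?(Lw 1%N isT) ?(Lw 2%N isT) ?(Lw 3%N isT) ?(Lw 4%N isT) ?(Lw 5%N
      isT) ?(Lw 6%N isT) ?(Lw 7%N isT) ?(Lw 8%N isT) /= -/sigma; ring.
  + have [l0 r0 b0] := ent (sw (e (Ordinal lti))) (e (Ordinal lti)) 0%N;
    have [l1 r1 b1] := ent (sw (e (Ordinal lti))) (e (Ordinal lti)) 1%N.
    rewrite ?psiE ?(l0, r0, b0, l1, r1, b1) ?plE// ?sw0 ?sw1 !eE//= -/sigma ?bE.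
    have : (1 : K) != 0 by exact: oner_neq0.
    by congr (_ != 0); ring.
(* This is s_1 (t_1 - 1), which detects t_1 = 1 without a division by s_1. *)
- apply: (simple _ (fun M => M (inord 1) e1 e1 - 1 - M (inord 1) e1 e0)).
  + by apply: (algebraB palg) => //; apply: (algebraB palg).
  + by move=> w; rewrite ?phipsi.
  + move=> w /flatE Lw; have [l0 r0 b0] := ent (sw w) w 0%N;
    have [l1 r1 b1] := ent (sw w) w 1%N.
    rewrite ?psiE ?(l0, r0, b0, l1, r1,
      b1) ?plE// ?sw0 ?sw1 ?(Lw 2%N isT) ?(Lw 3%N isT) ?(Lw 4%N isT) ?(Lw 5%N isT) ?(Lw 6%N
      isT) ?(Lw 7%N isT) ?(Lw 8%N isT) /= -/sigma; ring.
  + have [l0 r0 b0] := ent (sw (e (Ordinal lti))) (e (Ordinal lti)) 0%N;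
    have [l1 r1 b1] := ent (sw (e (Ordinal lti))) (e (Ordinal lti)) 1%N.
    rewrite ?psiE ?(l0, r0, b0, l1, r1, b1) ?plE// ?sw0 ?sw1 !eE//= -/sigma ?bE.
    have : sigma != 0 by exact: sigma0.
    by congr (_ != 0); ring.
- apply: (simple _ (fun M => M (inord 1) e1 e0 - sigma)).
  + exact: (algebraB palg).
  + by move=> w; rewrite ?phipsi.
  + move=> w /flatE Lw; have [l0 r0 b0] := ent (sw w) w 0%N;
    have [l1 r1 b1] := ent (sw w) w 1%N.
    rewrite ?psiE ?(l0, r0, b0, l1, r1,
      b1) ?plE// ?sw0 ?sw1 ?(Lw 3%N isT) ?(Lw 4%N isT) ?(Lw 5%N isT) ?(Lw 6%N isT) ?(Lw 7%N
      isT) ?(Lw 8%N isT) /= -/sigma; ring.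
  + have [l0 r0 b0] := ent (sw (e (Ordinal lti))) (e (Ordinal lti)) 0%N;
    have [l1 r1 b1] := ent (sw (e (Ordinal lti))) (e (Ordinal lti)) 1%N.
    rewrite ?psiE ?(l0, r0, b0, l1, r1, b1) ?plE// ?sw0 ?sw1 !eE//= -/sigma ?bE.
    have : (1 : K) != 0 by exact: oner_neq0.
    by congr (_ != 0); ring.
(* The coordinate t_2 is only seen in matrices that depend on s_2, so [psi] does not help. Here F is
   t_2 (x_2 - 1 - t_2 s_2 + s_2), in which s_2 cancels at t_2 = 1, leaving x_2 - 1. The numerator of
   F along [phi] serves as the polynomial [f]. *)
- pose F (M : quadruple K 3) := M (inord 2) e0 e1 + (M (inord 2) e1 e1 - 1).
  have FE w : w (inord 5) = 0 -> w (inord 6) = 0 -> w (inord 7) = 0 -> w (inord 8) = 0 ->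
      F (phi w) = w (inord 4) * (x (inord 2) - 1 - w (inord 4) * s2 w + s2 w).
    move=> w5 w6 w7 w8; have [l2 _ _] := ent (sol w) w 2%N.
    rewrite /F !phiE !l2 !plE// w7 w8 /sol eqxx (_ : (2 * 2)%N = 4)//=; ring.
  have pF : polyfun F by apply: (algebraD palg) => //; apply: (algebraB palg).
  have [N [p pE]] := rphi F pF.
  have qe : q.@[e (Ordinal lti)] != 0.
    rewrite -qE mulf_neq0 ?comm0 ?slope0 ?eE//= ?addr0//.
    have : - (x (inord 0) - 1) != 0 by rewrite oppr_eq0.
    by congr (_ != 0); ring.
  exists F, (fun w => p.@[w]); split.
  - exact: pF.
  - by exists 0%N, p => w _; rewrite expr0 mulr1.
  - by move=> w /flatE Lw _; rewrite FE ?(Lw 4) ?(Lw 5) ?(Lw 6) ?(Lw 7) ?(Lw 8)//= mul0r.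
  - by move=> w qwn; rewrite -pE// mulf_eq0 negb_or => /andP[].
  exists (e (Ordinal lti)); first exact: Le.
  rewrite -pE// mulf_neq0 ?expf_neq0// FE ?eE//= ?addr0//.
  by have : x (inord 2) - 1 != 0 by []; congr (_ != 0); ring.
- apply: (simple _ (fun M => M (inord 0) e0 e2)).
  + exact: pe.
  + by move=> w; rewrite ?phipsi.
  + move=> w /flatE Lw; have [l0 r0 b0] := ent (sw w) w 0%N;
    have [l1 r1 b1] := ent (sw w) w 1%N.
    rewrite ?psiE ?(l0, r0, b0, l1, r1,
      b1) ?plE// ?sw0 ?sw1 ?(Lw 5%N isT) ?(Lw 6%N isT) ?(Lw 7%N isT) ?(Lw 8%N isT) /= -/sigma;
      ring.
  + have [l0 r0 b0] := ent (sw (e (Ordinal lti))) (e (Ordinal lti)) 0%N;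
    have [l1 r1 b1] := ent (sw (e (Ordinal lti))) (e (Ordinal lti)) 1%N.
    rewrite ?psiE ?(l0, r0, b0, l1, r1, b1) ?plE// ?sw0 ?sw1 !eE//= -/sigma ?bE.
    have : x (inord 0) - 1 != 0 by exact: x10.
    by congr (_ != 0); ring.
(* For p = 0 the upper part of the last column of M_j is (A_j - 1) q. If also q_1 = 0, its first
   entry is q_0 times that of A_j - 1, with the same q_0 for both j, so the minor vanishes. At the
   test point it is - sigma (x_0 - 1). *)
- apply: (simple _ (fun M => M (inord 0) e0 e2 * (M (inord 1) e0 e0 - 1) - M (inord 1) e0 e2 *
  (M (inord 0) e0 e0 - 1))).
  + by apply: (algebraB palg); apply: (algebraM palg) => //; apply: (algebraB palg).
  + by move=> w; rewrite ?phipsi.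
  + move=> w /flatE Lw; have [l0 r0 b0] := ent (sw w) w 0%N;
    have [l1 r1 b1] := ent (sw w) w 1%N.
    rewrite ?psiE ?(l0, r0, b0, l1, r1,
      b1) ?plE// ?sw0 ?sw1 ?(Lw 6%N isT) ?(Lw 7%N isT) ?(Lw 8%N isT) /= -/sigma; ring.
  + have [l0 r0 b0] := ent (sw (e (Ordinal lti))) (e (Ordinal lti)) 0%N;
    have [l1 r1 b1] := ent (sw (e (Ordinal lti))) (e (Ordinal lti)) 1%N.
    rewrite ?psiE ?(l0, r0, b0, l1, r1, b1) ?plE// ?sw0 ?sw1 !eE//= -/sigma ?bE.
    have : - sigma * (x (inord 0) - 1) != 0 by exact: neq_sa.
    by congr (_ != 0); ring.
- apply: (simple _ (fun M => M (inord 0) e2 e0)).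
  + exact: pe.
  + by move=> w; rewrite ?phipsi.
  + move=> w /flatE Lw; have [l0 r0 b0] := ent (sw w) w 0%N;
    have [l1 r1 b1] := ent (sw w) w 1%N.
    rewrite ?psiE ?(l0, r0, b0, l1, r1,
      b1) ?plE// ?sw0 ?sw1 ?(Lw 7%N isT) ?(Lw 8%N isT) /= -/sigma; ring.
  + have [l0 r0 b0] := ent (sw (e (Ordinal lti))) (e (Ordinal lti)) 0%N;
    have [l1 r1 b1] := ent (sw (e (Ordinal lti))) (e (Ordinal lti)) 1%N.
    rewrite ?psiE ?(l0, r0, b0, l1, r1, b1) ?plE// ?sw0 ?sw1 !eE//= -/sigma ?bE.
    have : x (inord 0) - 1 != 0 by exact: x10.
    by congr (_ != 0); ring.
(* For p_1 = 0 the two entries used from M_j are p_0 and 1 - q_0 p_0 times the first entry of A_j -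
   1; their ratio does not depend on j, so the minor vanishes. *)
- apply: (simple _ (fun M => M (inord 0) e2 e0 * (M (inord 1) e0 e0 - 1) - M (inord 1) e2 e0 *
  (M (inord 0) e0 e0 - 1))).
  + by apply: (algebraB palg); apply: (algebraM palg) => //; apply: (algebraB palg).
  + by move=> w; rewrite ?phipsi.
  + move=> w /flatE Lw; have [l0 r0 b0] := ent (sw w) w 0%N;
    have [l1 r1 b1] := ent (sw w) w 1%N.
    rewrite ?psiE ?(l0, r0, b0, l1, r1, b1) ?plE// ?sw0 ?sw1 ?(Lw 8%N isT) /= -/sigma; ring.
  + have [l0 r0 b0] := ent (sw (e (Ordinal lti))) (e (Ordinal lti)) 0%N;
    have [l1 r1 b1] := ent (sw (e (Ordinal lti))) (e (Ordinal lti)) 1%N.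
    rewrite ?psiE ?(l0, r0, b0, l1, r1, b1) ?plE// ?sw0 ?sw1 !eE//= -/sigma ?bE.
    have : - sigma * (x (inord 0) - 1) != 0 by exact: neq_sa.
    by congr (_ != 0); ring.
Qed.


Lemma has_dim_subset_S : has_dim (subset_S C) 9.
Proof.
split; first exact: subset_S_chain.
by move=> m Z; apply: covered_dim_le => z; apply: subset_S_covered.
Qed.

End DimensionS.

Lemma has_dim_neq0 (K : fieldType) (E : vectType K) (X : set E) n : has_dim X n -> X !=set0.
Proof.
move=> [[Z [chZ _]] _]; have [[F _ ZF] [[z Zz] _]] := chZ 0%N (leq0n _).
by exists z; move: Zz; rewrite ZF => -[].
Qed.


Local Open Scope complex_scope.

Theorem mainTheorem14 (R : realType) (a b c d : R[i])
    (C := fun j : 'I_4 => reflection_class (tnth [tuple a; b; c; d] j)) :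
  a != 0 -> b != 0 -> c != 0 -> d != 0 ->
  a != 1 -> b != 1 -> c != 1 -> d != 1 ->
  a * b * c * d = 1 ->
  [/\ subset_T C !=set0,
      subset_S C !=set0,
      has_dim (subset_T C) 8,
      exists2 n : 'I_4 -> nat, (forall j, has_dim (C j) (n j)) &
        8%:Z = \sum_(j < 4) (n j)%:Z - 3%:Z ^+ 2 + 1
    & has_dim (subset_S C) 9].
Proof.
move=> a0 b0 c0 d0 a1 b1 c1 d1 prod1.
pose x := tnth [tuple a; b; c; d].
have xE (k : nat) : (k < 4)%N -> x (inord k) = [:: a; b; c; d]`_k.
  by move=> k4; rewrite /x (tnth_nth 0) inordK.
have x0 j : x j != 0 by elim/ord4_ind: j; rewrite xE.
have x1 j : x j != 1 by elim/ord4_ind: j; rewrite xE.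
have prod_x : x (inord 0) * x (inord 1) * x (inord 2) * x (inord 3) = 1 by rewrite !xE.
have dimT : has_dim (subset_T C) 8 by exact: has_dim_subset_T x0 x1 prod_x.
have dimS : has_dim (subset_S C) 9 by exact: has_dim_subset_S x0 x1 prod_x.
split=> //; [exact: has_dim_neq0 dimT|exact: has_dim_neq0 dimS|].
exists (fun=> 4) => [j|]; first exact: (has_dim_reflection_class (x1 j)).
by rewrite sumr_const card_ord.
Qed.
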